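(* Let $\alpha,\beta\in\mathbb{R}$ with $4\alpha-\beta^2>0$, and let $A_{\alpha,\beta}$ be the generalized complex algebra with structure polynomial $X^2+\beta X+\alpha$. Let $\Omega$ be a simply connected and bounded domain in the plane with sufficiently smooth boundary $\partial\Omega$, and let $\zeta\in\Omega$. Suppose $f:\overline{\Omega}\to A_{\alpha,\beta}$ is continuously differentiable (with respect to the real variables $x,y$) on $\overline{\Omega}$. Then $$f(\zeta)=\frac{1}{2\pi\hat{i}}\int_{\partial\Omega}\frac{f(z)}{\widetilde{z-\zeta}}\,d\tilde z-\frac{1}{\pi\hat{i}}\iint_{\Omega}\frac{\partial_{\bar z}f(z)}{\widetilde{z-\zeta}}\,dx\,dy .$$
   Context: $A_{\alpha,\beta}$ is the commutative $2$-dimensional real algebra of elements $x+iy$ ($x,y\in\mathbb{R}$) with product determined by $i^2=-\beta i-\alpha$, i.e. $(x_1+iy_1)(x_2+iy_2)=(x_1x_2-\alpha y_1y_2)+i(x_1y_2+y_1x_2-\beta y_1y_2)$. When $4\alpha-\beta^2>0$ (elliptic type), every nonzero element is invertible, and a quotient $a/b$ means $a\,b^{-1}$ in $A_{\alpha,\beta}$. Points $(x,y)$ of the plane are identified with $z=x+iy\in A_{\alpha,\beta}$. All products and quotients are taken in $A_{\alpha,\beta}$. Notation: for $z=x+iy$, $\tilde z=y-ix$ (so for $\zeta=\xi+i\eta$, $\widetilde{z-\zeta}=(y-\eta)-i(x-\xi)$); $d\tilde z=dy-i\,dx$, i.e. $\int_\gamma g\,d\tilde z=\int_\gamma g\,dy-i\int_\gamma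 g\,dx$ for $A_{\alpha,\beta}$-valued $g$; $\hat{i}=\dfrac{\beta+2i}{\sqrt{4\alpha-\beta^2}}\in A_{\alpha,\beta}$. The Cauchy-Riemann operator is $\partial_{\bar z}f=\frac12\left(\frac{\partial f}{\partial x}+i\,\frac{\partial f}{\partial y}\right)$. The boundary $\partial\Omega$ is positively oriented, and ''sufficiently smooth boundary'' means that the Green-Gauss formulas $\iint_\Omega\partial_x g\,dx\,dy=\int_{\partial\Omega}g\,dy$ and $\iint_\Omega\partial_y g\,dx\,dy=-\int_{\partial\Omega}g\,dx$ hold for every $g$ continuously differentiable on $\overline\Omega$. *)

(* Defs.v *)
From HB Require Import structures.
From mathcomp Require Import all_boot all_order all_algebra.
From mathcomp Require Import all_classical all_reals all_analysis.
From mathcomp Require Import ring lra.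

Set Implicit Arguments.
Unset Strict Implicit.
Unset Printing Implicit Defensive.

Import Order.TTheory GRing.Theory Num.Theory.
Import numFieldNormedType.Exports.

Local Open Scope classical_set_scope.
Local Open Scope ring_scope.

(* The parameters alpha and beta only occur in the product. *)
Record gcomplex (R : realType) (alpha beta : R) : Type :=
  GComplex { gRe : R ; gIm : R }.

Arguments GComplex {R alpha beta} gRe gIm.

Section GComplexAlgebra.
Context {R : realType} {alpha beta : R}.
Local Notation A := (gcomplex alpha beta).
Implicit Types z w : A.

Definition gpair z : R * R := (gRe z, gIm z).
Definition gof_pair (p : R * R) : A := GComplex p.1 p.2.

Lemma gpairK : cancel gpair gof_pair.
Proof. by case. Qed.

HB.instance Definition _ := Choice.copy A (can_type gpairK).

Definition gadd z w : A := GComplex (gRe z + gRe w) (gIm z + gIm w).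
Definition gopp z : A := GComplex (- gRe z) (- gIm z).

Lemma gaddA : associative gadd.
Proof. by case=> ? ? [? ?] [? ?]; rewrite /gadd /= !addrA. Qed.
Lemma gaddC : commutative gadd.
Proof. by case=> a b [c d]; rewrite /gadd /= (addrC a) (addrC b). Qed.
Lemma gadd0 : left_id (GComplex 0 0) gadd.
Proof. by case=> ? ?; rewrite /gadd /= !add0r. Qed.
Lemma gaddN : left_inverse (GComplex 0 0) gopp gadd.
Proof. by case=> ? ?; rewrite /gadd /= !addNr. Qed.

HB.instance Definition _ := GRing.isZmodule.Build A gaddA gaddC gadd0 gaddN.

Definition gmul z w : A :=
  GComplex (gRe z * gRe w - alpha * gIm z * gIm w)
           (gRe z * gIm w + gIm z * gRe w - beta * gIm z * gIm w).

Lemma gmulA : associative gmul.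
Proof. by case=> ? ? [? ?] [? ?]; rewrite /gmul /=; congr GComplex; ring. Qed.
Lemma gmulC : commutative gmul.
Proof. by case=> ? ? [? ?]; rewrite /gmul /=; congr GComplex; ring. Qed.
Lemma gmul1 : left_id (GComplex 1 0) gmul.
Proof. by case=> ? ?; rewrite /gmul /=; congr GComplex; ring. Qed.
Lemma gmulDl : left_distributive gmul gadd.
Proof. by case=> ? ? [? ?] [? ?]; rewrite /gmul /gadd /=; congr GComplex; ring. Qed.
Lemma gone_neq0 : GComplex 1 0 != 0 :> A.
Proof. by apply/eqP => -[] /eqP; rewrite oner_eq0. Qed.

HB.instance Definition _ :=
  GRing.Zmodule_isComNzRing.Build A gmulA gmulC gmul1 gmulDl gone_neq0.

(* z is a unit iff its norm x^2 - beta x y + alpha y^2 is nonzero; the inverse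
   is then the conjugate (x - beta y) - i y divided by the norm. *)
Definition gnorm z : R :=
  gRe z ^+ 2 - beta * gRe z * gIm z + alpha * gIm z ^+ 2.

Definition ginv z : A :=
  if gnorm z == 0 then z
  else GComplex ((gRe z - beta * gIm z) / gnorm z) (- gIm z / gnorm z).

Lemma gnormM z w : gnorm (z * w) = gnorm z * gnorm w.
Proof. by case: z w => ? ? [? ?]; rewrite /gnorm /=; ring. Qed.

Lemma gmulV : {in [pred z | gnorm z != 0], left_inverse 1 ginv *%R}.
Proof.
move=> z; rewrite inE => nz; rewrite /ginv (negbTE nz).
case: z nz => x y nz; have nz' := nz; rewrite /gnorm /= in nz'.
by congr GComplex; rewrite /gnorm /=; field.
Qed.

Lemma gunitPl z w : w * z = 1 -> [pred z : A | gnorm z != 0] z.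
Proof.
move=> /(congr1 gnorm); rewrite gnormM => h /=; apply/eqP => z0.
move: h; rewrite z0 mulr0 /gnorm /= expr1n !mulr0 expr0n /= mulr0 subr0 addr0.
by move/eqP; rewrite eq_sym oner_eq0.
Qed.

Lemma ginv_out : {in [predC [pred z : A | gnorm z != 0]], ginv =1 id}.
Proof. by move=> z; rewrite !inE negbK /ginv => ->. Qed.

HB.instance Definition _ :=
  GRing.ComNzRing_hasMulInverse.Build A gmulV gunitPl ginv_out.

Definition gscale (a : R) z : A := GComplex (a * gRe z) (a * gIm z).

Lemma gscaleA a b z : gscale a (gscale b z) = gscale (a * b) z.
Proof. by rewrite /gscale /= !mulrA. Qed.
Lemma gscale1 : left_id 1 gscale.
Proof. by case=> ? ?; rewrite /gscale /= !mul1r. Qed.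
Lemma gscaleDr : right_distributive gscale +%R.
Proof. by move=> a z w; congr GComplex; exact: mulrDr. Qed.
Lemma gscaleDl z : {morph gscale^~ z : a b / a + b}.
Proof. by move=> a b; congr GComplex; exact: mulrDl. Qed.

HB.instance Definition _ :=
  GRing.Zmodule_isLmodule.Build R A gscaleA gscale1 gscaleDr gscaleDl.

Lemma gscaleAl (a : R) z w : a *: (z * w) = (a *: z) * w.
Proof. by case: z w => ? ? [? ?]; congr GComplex => /=; ring. Qed.

HB.instance Definition _ := GRing.Lmodule_isLalgebra.Build R A gscaleAl.
HB.instance Definition _ := GRing.Lalgebra_isComAlgebra.Build R A.

Definition gi : A := GComplex 0 1.

Lemma gi_sqr : gi ^+ 2 = - (beta *: gi) - alpha%:A.
Proof. by rewrite expr2; congr GComplex => /=; ring. Qed.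

Lemma gunit_elliptic z :
  0 < 4 * alpha - beta ^+ 2 -> (z \is a GRing.unit) = (z != 0).
Proof.
move=> ell; apply/idP/idP => [|z0]; first by apply: contraTneq => ->; rewrite unitr0.
change (gnorm z != 0); apply: contra z0 => /eqP nz.
case: z nz => x y; rewrite /gnorm /= => nz.
have sq : (2 * x - beta * y) ^+ 2 + (4 * alpha - beta ^+ 2) * y ^+ 2 = 0.
  by rewrite -[RHS](mulr0 4) -nz; ring.
have y2 : 0 <= (4 * alpha - beta ^+ 2) * y ^+ 2.
  exact: mulr_ge0 (ltW ell) (sqr_ge0 y).
have /eqP := sq; rewrite paddr_eq0 ?sqr_ge0//.
rewrite sqrf_eq0 mulf_eq0 (gt_eqF ell) /= sqrf_eq0 => /andP[+ /eqP y0].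
rewrite y0 mulr0 subr0 mulf_eq0 pnatr_eq0 /= => /eqP ->; exact/eqP.
Qed.

(* z = x + i y is sent to y - i x; accordingly d(gtilde z) = dy - i dx in the
   line integrals below. *)
Definition gtilde z : A := GComplex (gIm z) (- gRe z).

Definition ghat : A := (Num.sqrt (4 * alpha - beta ^+ 2))^-1 *: (beta%:A + 2 *: gi).

End GComplexAlgebra.

Arguments ghat {R} alpha beta.

(* The plane is R * R; gof_pair identifies (x, y) with x + i y. *)

Section Plane.
Context {R : realType}.
Local Notation lebesgue2 := (@lebesgue_measure R \x @lebesgue_measure R)%E.
Implicit Types (D : set (R * R)) (c : R -> R * R) (g : R * R -> R).

Definition partial_x g : R * R -> R := 'D_((1, 0) : R * R) g.
Definition partial_y g : R * R -> R := 'D_((0, 1) : R * R) g.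

(* Continuous differentiability on the closure of an open D: g is continuous on
   the closure, and the partial derivatives exist in D and extend continuously
   to the closure.  Values of g outside the closure are irrelevant. *)
Definition C1_closure D g : Prop :=
  [/\ {within closure D, continuous g},
      forall z, D z -> derivable g z ((1, 0) : R * R) /\
                       derivable g z ((0, 1) : R * R),
      exists gx : R * R -> R, {within closure D, continuous gx} /\
                              (forall z, D z -> gx z = partial_x g z)
    & exists gy : R * R -> R, {within closure D, continuous gy} /\
                              (forall z, D z -> gy z = partial_y g z)].

Definition domain D : Prop := [/\ open D, connected D & D !=set0].

(* Every loop in D is freely homotopic in D to a constant loop. *)
Definition simply_connected D : Prop :=
  forall c, {within `[0, 1], continuous c} -> c @` `[0, 1] `<=` D ->
    c 0 = c 1 ->
  exists (H : R * R -> R * R) (p : R * R),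
    [/\ {within `[0, 1] `*` `[0, 1], continuous H},
        H @` (`[0, 1] `*` `[0, 1]) `<=` D,
        forall t : R, 0 <= t <= 1 -> H (0, t) = c t,
        forall t : R, 0 <= t <= 1 -> H (1, t) = p
      & forall s : R, 0 <= s <= 1 -> H (s, 0) = H (s, 1)].

(* A closed rectifiable curve (in a Lipschitz parametrization, e.g. a piecewise
   C1 one) tracing the boundary of D.  Injectivity on [0, 1[ is not needed: the
   Green-Gauss formulas below already determine the values of the line
   integrals over the boundary. *)
Definition boundary_curve D c : Prop :=
  [/\ [lipschitz c t | t in `[0, 1]],
      c 0 = c 1
    & c @` `[0, 1] = closure D `\` interior D].

Definition speed_x c : R -> R := derive1 (fst \o c).
Definition speed_y c : R -> R := derive1 (snd \o c).

(* D lies to the left of c: at each point with a nonzero velocity (x', y'), the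
   left normal (- y', x') points into D. *)
Definition positively_oriented D c : Prop :=
  forall t : R, 0 < t < 1 ->
    derivable (fst \o c) t 1 -> derivable (snd \o c) t 1 ->
    (speed_x c t, speed_y c t) != (0, 0) ->
  \forall s \near 0^'+, D ((c t).1 - s * speed_y c t, (c t).2 + s * speed_x c t).

(* The velocity of a Lipschitz curve exists almost everywhere. *)
Definition line_integral_dx c g : R :=
  \int[lebesgue_measure]_(t in `[0, 1]) (g (c t) * speed_x c t).
Definition line_integral_dy c g : R :=
  \int[lebesgue_measure]_(t in `[0, 1]) (g (c t) * speed_y c t).

Definition green_gauss D c : Prop :=
  forall g, C1_closure D g ->
    \int[lebesgue2]_(z in D) partial_x g z = line_integral_dy c g /\
    \int[lebesgue2]_(z in D) partial_y g z = - line_integral_dx c g.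

End Plane.

Section GComplexAnalysis.
Context {R : realType} {alpha beta : R}.
Local Notation A := (gcomplex alpha beta).
Local Notation lebesgue2 := (@lebesgue_measure R \x @lebesgue_measure R)%E.
Implicit Types (D : set (R * R)) (c : R -> R * R) (f : R * R -> A).

Definition gC1_closure D f : Prop :=
  C1_closure D (@gRe _ _ _ \o f) /\ C1_closure D (@gIm _ _ _ \o f).

Definition gpartial_x f (z : R * R) : A :=
  GComplex (partial_x (@gRe _ _ _ \o f) z) (partial_x (@gIm _ _ _ \o f) z).
Definition gpartial_y f (z : R * R) : A :=
  GComplex (partial_y (@gRe _ _ _ \o f) z) (partial_y (@gIm _ _ _ \o f) z).

Definition dbar f (z : R * R) : A :=
  2^-1 *: (gpartial_x f z + gi * gpartial_y f z).

Definition garea_integral D f : A :=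
  GComplex (\int[lebesgue2]_(z in D) gRe (f z))
           (\int[lebesgue2]_(z in D) gIm (f z)).

Definition gline_integral_dx c f : A :=
  GComplex (line_integral_dx c (@gRe _ _ _ \o f))
           (line_integral_dx c (@gIm _ _ _ \o f)).
Definition gline_integral_dy c f : A :=
  GComplex (line_integral_dy c (@gRe _ _ _ \o f))
           (line_integral_dy c (@gIm _ _ _ \o f)).

Definition gline_integral_dtilde c f : A :=
  gline_integral_dy c f - gi * gline_integral_dx c f.

End GComplexAnalysis.

(* Main.v *)
Require Import Defs.
From HB Require Import structures.
From mathcomp Require Import all_boot all_order all_algebra.
From mathcomp Require Import all_classical all_reals all_analysis.
From mathcomp Require Import measurable_realfun ring lra.

Set Implicit Arguments.
Unset Strict Implicit.
Unset Printing Implicit Defensive.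

Import Order.TTheory GRing.Theory Num.Theory.
Import numFieldNormedType.Exports.

Local Open Scope classical_set_scope.
Local Open Scope ring_scope.

(** The idea is to apply the Green-Gauss formulas to the product of f with a
continuously differentiable truncation of the Cauchy kernel, so that no disc has
to be removed from the domain and no line integral has to be taken to the limit.

Write w for the value of tilde at z - zeta, and q for its norm, the positive
definite quadratic form q = w * conj w. The kernel 1 / w equals q^-1 *: conj w.
For d > 0 the kernel K_d is obtained from it by replacing q^-1, on the ellipse
q < d, by the tangent line at d of the function t^-1 (cutinv, cutker). It is
continuously differentiable on the whole plane, and since dbar is a derivation
that vanishes on w while 2 dbar (conj w) = beta + 2 i,
<<
    2 dbar K_d = B_d *: (beta + 2 i),   B_d = 2 / d ^ 2 * max (0, d - q)
>>
(cutker_C1). The bump B_d is supported in the ellipse q <= d, and its integral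
over the plane is 2 pi / sqrt (4 alpha - beta^2), whatever d is
(integral_mollifier); multiplied by beta + 2 i this gives 2 pi times the
imaginary unit ghat.

As soon as the ellipse lies in the domain, K_d = 1 / w on the boundary, and the
Green-Gauss formulas, in the form of green_dtilde, give the exact identity
<<
    int f / w dtilde = iint 2 dbar f * K_d + iint f * B_d *: (beta + 2 i).
>>
The first area integral differs from that of 2 dbar f / w by at most a constant
times the integral of 1 / |z - zeta| over a small square, and the second one from
f zeta * (2 pi *: ghat) by at most a constant times the oscillation of f on the
ellipse. Both errors tend to 0 with d (cauchy_pompeiu_defect).

The kernel 1 / |z - zeta| is dominated by a product of one-variable functions
1 / sqrt |x - a| (gsize_cauchy), whose integrals over small intervals are
elementary; this yields at the same time the integrability of 2 dbar f / w and
the explicit smallness used above (singular_integral_bound). *)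

(** * Measurability and compactness in the plane *)

Section Plane.
Context {R : realType}.
Implicit Types (U D : set (R * R)).

Lemma open_box U z : open U -> U z -> exists2 e : R, 0 < e &
  forall y, `|z.1 - y.1| < e -> `|z.2 - y.2| < e -> U y.
Proof.
rewrite openE => oU /oU; rewrite /interior -nbhs_ballE => -[e /= e0 eU].
by exists e => // y y1 y2; apply: eU; split.
Qed.

(** The product sigma-algebra contains the open sets because the plane has a
    countable base: an open set is the union of the rational squares in it. *)
Lemma open_measurable2 U : open U -> measurable U.
Proof.
move=> oU.
pose B (i : rat * rat * nat) : set (R * R) :=
  ball (ratr i.1.1 : R) i.2.+1%:R^-1 `*` ball (ratr i.1.2 : R) i.2.+1%:R^-1.
have -> : U = \bigcup_(i in [set i | B i `<=` U]) B i.
  apply/seteqP; split=> [z Uz|z [i]]; last by apply.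
  have [e e0 zeU] := open_box oU Uz.
  have [n ne] : exists n : nat, n.+1%:R^-1 < e / 2.
    have [n] := ltr_add_invr (divr_gt0 e0 (ltr0n R 2)).
    by rewrite add0r; exists n.
  have n0 : (0 : R) < n.+1%:R^-1 by rewrite invr_gt0.
  have /rat_in_itvoo[p /=] : z.1 - n.+1%:R^-1 < z.1 + n.+1%:R^-1 by move: n0; set u := n.+1%:R^-1; lra.
  have /rat_in_itvoo[q /=] : z.2 - n.+1%:R^-1 < z.2 + n.+1%:R^-1 by move: n0; set u := n.+1%:R^-1; lra.
  rewrite !in_itv/= -2!ltr_distlC => qz pz.
  exists (p, q, n); last by split; rewrite /= /ball/= distrC.
  move=> y [/=]; rewrite /ball/= => yp yq; apply: zeU.
  - rewrite -(subrK (ratr p) z.1) -addrA (le_lt_trans (ler_normD _ _))//; move: ne pz yp; set u := n.+1%:R^-1; lra.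
  - rewrite -(subrK (ratr q) z.2) -addrA (le_lt_trans (ler_normD _ _))//; move: ne qz yq; set u := n.+1%:R^-1; lra.
rewrite bigcup_mkcond.
apply: countable_bigcupT_measurable => // i.
case: ifPn => // _.
by apply: measurableX; exact: open_measurable (ball_open _ _).
Qed.

Lemma within_continuous_measurable2 D (g : R * R -> R) :
  measurable D -> {within D, continuous g} -> measurable_fun D g.
Proof.
move=> mD /continuousP cg; apply: (measurability _ (RGenOpens.measurableE R)).
move=> _ [_ [a [b ->] <-]].
have /cg/open_subspaceP [V oV VD] : open (`]a, b[%classic : set R).
  exact: interval_open.
by rewrite setIC -VD; apply: measurableI => //; exact: open_measurable2.
Qed.

Lemma bounded_closure_compact D : bounded_set D -> compact (closure D).
Proof.
move=> /pinfty_ex_gt0 [M _ DM].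
have DMM : D `<=` `[- M, M] `*` `[- M, M].
  move=> z /DM/=; rewrite prod_normE ge_max => /andP[z1 z2].
  by split; rewrite /= in_itv/= -ler_norml.
have cMM : compact (`[- M, M] `*` `[- M, M] : set (R * R)).
  by apply: compact_setX; exact: segment_compact.
apply: (subclosed_compact _ cMM); first exact: closed_closure.
have hR : hausdorff_space (R * R)%type by exact: norm_hausdorff.
have /closure_id -> := compact_closed hR cMM.
exact: closure_subset.
Qed.

Lemma within_closure_bounded D (g : R * R -> R) :
  bounded_set D -> {within closure D, continuous g} ->
  exists M, forall z, closure D z -> `|g z| <= M.
Proof.
move=> /bounded_closure_compact cD cg.
have /compact_bounded/pinfty_ex_gt0[M _ gM] := continuous_compact cg cD.
by exists M => z Dz; apply: gM; exists z.
Qed.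

End Plane.

(** * An integrable singularity on the line *)

Section OneDim.
Context {R : realType}.
Local Notation mu := (@lebesgue_measure R).

Lemma FTC2_is_derive (f F : R -> R) (a b : R) : a <= b ->
  (forall x, a <= x <= b -> is_derive x 1 F (f x)) ->
  {within `[a, b], continuous f} ->
  (\int[mu]_(x in `[a, b]) (f x)%:E)%E = (F b - F a)%:E.
Proof.
rewrite le_eqVlt => /predU1P[<-|ab] dF cf.
  by rewrite set_itv1 integral_set1 subrr.
have cF x : a <= x <= b -> {for x, continuous F}.
  move=> /dF[dFx _]; exact/differentiable_continuous/derivable1_diffP.
rewrite (@continuous_FTC2 _ f F)//; first split.
- by move=> x /[!in_itv]/= /andP[ax xb]; case: (dF x) => //; rewrite !ltW.
- by apply: cvg_at_right_filter; apply: cF; rewrite lexx ltW.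
- by apply: cvg_at_left_filter; apply: cF; rewrite lexx ltW.
- move=> x /[!in_itv]/= /andP[ax xb].
  by rewrite derive1E; apply: (@derive_val _ _ _ _ _ _ _ (dF _ _)); rewrite !ltW.
Qed.

(** The value at the singularity is +oo, and not the 0 that the inverse would
    give, so that the bound gsize_cauchy holds on the two axes through zeta too. *)
Definition invsqrt (a x : R) : \bar R :=
  if x == a then +oo%E else (Num.sqrt `|x - a|)^-1%:E.

Lemma invsqrt_ge0 a x : (0 <= invsqrt a x)%E.
Proof. by rewrite /invsqrt; case: ifPn => // _; rewrite lee_fin invr_ge0. Qed.

Lemma measurable_invsqrt a D : measurable_fun D (invsqrt a).
Proof.
apply: measurable_funTS; apply: measurable_fun_ifT => //.
  apply: (measurable_fun_bool true); rewrite setTI.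
  have -> : (fun x => x == a) @^-1` [set true] = [set a].
    by apply/seteqP; split=> x /= /eqP.
  exact: measurable_set1.
apply/measurable_EFinP.
rewrite (_ : (fun x => _) = (@powR R ^~ (- 2^-1)) \o (fun x => `|x - a|)).
  apply: measurableT_comp; first exact: measurable_powR.
  by apply: measurableT_comp => //; exact: measurable_funB.
by apply/funext => x /=; rewrite powRN powR12_sqrt.
Qed.

Lemma integral_invsqrt_right (a e r : R) : 0 < e -> e <= r ->
  (\int[mu]_(x in `[(a + e)%R, (a + r)%R]) invsqrt a x =
   (2 * Num.sqrt r - 2 * Num.sqrt e)%:E)%E.
Proof.
move=> e0 er.
rewrite (@eq_integral _ _ _ mu _ (fun x => ((Num.sqrt (x - a))^-1)%:E)); last first.
  move=> x /[!inE]/= /[!in_itv]/= /andP[aex _].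
  rewrite /invsqrt gt_eqF; last lra.
  by rewrite ger0_norm//; lra.
apply: (etrans (@FTC2_is_derive _ (fun x => 2 * Num.sqrt (x - a)) _ _ _ _ _)).
- lra.
- move=> x xa; have xa0 : 0 < x - a by lra.
  have := is_derive1_sqrt xa0 => dxa.
  apply: is_derive_eq.
  rewrite /GRing.scale/= subr0 mulr1.
  have : Num.sqrt (x - a) != 0 by rewrite sqrtr_eq0 -ltNge.
  by move=> ?; field.
- apply: continuous_in_subspaceT => x.
  rewrite inE/= in_itv/= => xa.
  apply: cvgV; first by rewrite sqrtr_eq0 -ltNge; lra.
  apply: continuous_comp; last exact: sqrt_continuous.
  by apply: cvgB; [exact: cvg_id|exact: cvg_cst].
- by rewrite !(addrC a) !addrK.
Qed.

Lemma integral_invsqrt_left (a e r : R) : 0 < e -> e <= r ->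
  (\int[mu]_(x in `[(a - r)%R, (a - e)%R]) invsqrt a x =
   (2 * Num.sqrt r - 2 * Num.sqrt e)%:E)%E.
Proof.
move=> e0 er.
rewrite (@eq_integral _ _ _ mu _ (fun x => ((Num.sqrt (a - x))^-1)%:E)); last first.
  move=> x /[!inE]/= /[!in_itv]/= /andP[_ aex].
  rewrite /invsqrt lt_eqF; last lra.
  by rewrite ltr0_norm ?opprB//; lra.
apply: (etrans (@FTC2_is_derive _ (fun x => - 2 * Num.sqrt (a - x)) _ _ _ _ _)).
- lra.
- move=> x xa; have xa0 : 0 < a - x by lra.
  have := is_derive1_sqrt xa0 => dxa.
  apply: is_derive_eq.
  rewrite /GRing.scale/=.
  have : Num.sqrt (a - x) != 0 by rewrite sqrtr_eq0 -ltNge.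
  by move=> ?; field.
- apply: continuous_in_subspaceT => x.
  rewrite inE/= in_itv/= => xa.
  apply: cvgV; first by rewrite sqrtr_eq0 -ltNge; lra.
  apply: continuous_comp; last exact: sqrt_continuous.
  by apply: cvgB; [exact: cvg_cst|exact: cvg_id].
- by rewrite !subKr; congr EFin; lra.
Qed.

(** The interval punctured at a is the increasing union of sets on which the
    primitive 2 * sqrt |x - a| applies, and a point is a null set. *)
Lemma integral_invsqrt (a r : R) : 0 < r ->
  (\int[mu]_(x in `[(a - r)%R, (a + r)%R]) invsqrt a x <= (4 * Num.sqrt r)%:E)%E.
Proof.
move=> r0.
pose e (n : nat) : R := r / n.+1%:R.
have e0 n : 0 < e n by rewrite divr_gt0.
have er n : e n <= r by rewrite ler_pdivrMr// ler_peMr ?ler1n// ltW.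
pose F n := `[a - r, a - e n] `|` `[a + e n, a + r].
have -> : `[a - r, a + r]%classic = \bigcup_n F n `|` [set a].
  apply/seteqP; split=> [x|x [[n _]|->]]/=; rewrite ?in_itv/=; last 2 first.
  - have := e0 n; have := er n; rewrite /F/= !in_itv/= => ? ? [] ?; lra.
  - by rewrite /=; lra.
  move=> xr; have [->|xa] := eqVneq x a; first by right.
  left.
  have xa0 : 0 < `|x - a| by rewrite normr_gt0 subr_eq0.
  have [n ne] : exists n, e n < `|x - a|.
    have [n] := ltr_add_invr (divr_gt0 xa0 r0).
    by rewrite add0r ltr_pdivlMr// mulrC; exists n.
  exists n => //; rewrite /F/= !in_itv/=.
  have [xlt|xge] := ltrP x a.
    by left; move: ne; rewrite ltr0_norm; lra.
  by right; move: ne; rewrite ger0_norm; lra.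
have mF n : measurable (F n) by exact: measurableU.
rewrite ge0_integral_setU//=; last 4 first.
- exact: bigcupT_measurable.
- exact: measurable_invsqrt.
- by move=> x _; exact: invsqrt_ge0.
- rewrite disj_set2E; apply/eqP/seteqP; split => // x [[n _]]/= + xa.
  by rewrite /F xa/= !in_itv/=; have := e0 n; have := er n; case; lra.
rewrite integral_set1 adde0.
have ndF : nondecreasing_seq F.
  apply/nondecreasing_seqP => n; rewrite subsetEset => x.
  have : e n.+1 <= e n.
    by rewrite ler_pM2l// lef_pV2 ?posrE// ler_nat.
  by rewrite /F/= !in_itv/= => ?; case; [left|right]; lra.
have cF : (\int[mu]_(x in F n) invsqrt a x)%E @[n --> \oo] -->
    (\int[mu]_(x in \bigcup_n F n) invsqrt a x)%E.
  apply: ge0_nondecreasing_set_cvg_integral => //.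
  - by move=> n; exact: measurable_invsqrt.
  - by move=> n x _; exact: invsqrt_ge0.
rewrite -(cvg_lim _ cF)//; apply: lime_le; first by apply/cvg_ex; eexists; exact: cF.
near=> n; rewrite ge0_integral_setU//=; last 3 first.
- exact: measurable_invsqrt.
- by move=> x _; exact: invsqrt_ge0.
- rewrite disj_set2E; apply/eqP/seteqP; split => // x []/=; rewrite !in_itv/=.
  by have := e0 n; lra.
rewrite integral_invsqrt_left// integral_invsqrt_right// -EFinD lee_fin.
by have := sqrtr_ge0 (e n); lra.
Unshelve. all: by end_near. Qed.

End OneDim.

(** * Two explicit plane integrals *)

Section PlaneIntegrals.
Context {R : realType}.
Local Notation mu := (@lebesgue_measure R).
Local Notation mu2 := (@lebesgue_measure R \x @lebesgue_measure R)%E.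

(** By Tonelli's theorem the integral is a product of two one-variable ones. *)
Lemma integral_invsqrt2 (a b r : R) : 0 < r ->
  (\int[mu2]_(z in `[(a - r)%R, (a + r)%R] `*` `[(b - r)%R, (b + r)%R])
     (invsqrt a z.1 * invsqrt b z.2) <= (16 * r)%:E)%E.
Proof.
move=> r0; set I := `[a - r, a + r]%classic; set J := `[b - r, b + r]%classic.
rewrite integral_mkcond.
rewrite (_ : _ \_ _ =
    (fun z => (invsqrt a \_ I) z.1 * (invsqrt b \_ J) z.2)%E); last first.
  apply/funext => -[x y]; rewrite !patchE in_setX/=.
  by case: (x \in I) => /=; case: (y \in J); rewrite ?mul0e ?mule0.
have mI : measurable_fun setT (invsqrt a \_ I).
  by apply/(measurable_restrictT (invsqrt a) (measurable_itv _)); exact: measurable_invsqrt.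
have mJ : measurable_fun setT (invsqrt b \_ J).
  by apply/(measurable_restrictT (invsqrt b) (measurable_itv _)); exact: measurable_invsqrt.
have I0 x : (0 <= (invsqrt a \_ I) x)%E.
  by rewrite patchE; case: ifPn => // _; exact: invsqrt_ge0.
have J0 x : (0 <= (invsqrt b \_ J) x)%E.
  by rewrite patchE; case: ifPn => // _; exact: invsqrt_ge0.
rewrite fubini_tonelli1/=; last 2 first.
- apply: emeasurable_funM.
  + exact: (measurableT_comp mI measurable_fst).
  + exact: (measurableT_comp mJ measurable_snd).
- by move=> z; rewrite mule_ge0.
rewrite /fubini_F/=.
under eq_integral do rewrite ge0_integralZl//.
rewrite ge0_integralZr//; last exact: integral_ge0.
rewrite -!integral_mkcond.
apply: (@le_trans _ _ ((4 * Num.sqrt r)%:E * (4 * Num.sqrt r)%:E)%E).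
  apply: lee_pmul; [| |exact: integral_invsqrt|exact: integral_invsqrt];
    by apply: integral_ge0 => x _; exact: invsqrt_ge0.
have s2 := sqr_sqrtr (ltW r0); rewrite -EFinM lee_fin -{3}s2; lra.
Qed.

(** For q <= 0 both sides vanish, the square root of a negative number being 0;
    this lets the outer integration range over the whole line. *)
Lemma integral_parabola (q m : R) :
  (\int[mu]_y (Num.max 0 (q - (y - m) ^+ 2))%:E = (4 / 3 * Num.sqrt q ^+ 3)%:E)%E.
Proof.
have [q0|q0] := leP q 0.
  rewrite ler0_sqrtr// expr0n/= mulr0 integral0_eq// => y _.
  by rewrite max_l//; have := sqr_ge0 (y - m); lra.
set s := Num.sqrt q; have s0 : 0 < s by rewrite sqrtr_gt0.
have qs : q = s ^+ 2 by rewrite sqr_sqrtr ?ltW.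
transitivity (\int[mu]_(y in `[(m - s)%R, (m + s)%R]) (q - (y - m) ^+ 2)%:E)%E.
  rewrite [RHS]integral_mkcond; apply: eq_integral => y _; rewrite patchE.
  case: ifPn; rewrite ?inE ?notin_setE/= in_itv/= => ys; congr EFin.
    by rewrite max_r// qs; nra.
  rewrite max_l// qs.
  have [?|?] := ltP y (m - s); first by nra.
  have [?|?] := ltP (m + s) y; first by nra.
  by exfalso; apply: ys; lra.
apply: (etrans (@FTC2_is_derive _ _ (fun y => q * y - (y - m) ^+ 3 / 3) _ _ _ _ _)).
- lra.
- move=> x _; apply: is_derive_eq.
  by rewrite /GRing.scale/=; field.
- apply: continuous_subspaceT => x.
  by apply/differentiable_continuous/derivable1_diffP; exact: ex_derive.
- by congr EFin; rewrite qs; field.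
Qed.

Lemma integral_cos4 :
  (\int[mu]_(t in `[(- (pi / 2))%R, (pi / 2)%R]) (cos t ^+ 4)%:E = (3 / 8 * pi)%:E)%E.
Proof.
apply: (etrans (@FTC2_is_derive _ _ (fun t => (3 * t + 3 * sin t * cos t
                 + 2 * sin t * cos t ^+ 3) / 8) _ _ _ _ _)).
- by have := pi_gt0 R; lra.
- move=> x _; apply: is_derive_eq.
  rewrite /GRing.scale/=; have := cos2Dsin2 x => cs.
  have -> : cos x ^+ 4 = 3 / 8 * (cos x ^+ 2 + sin x ^+ 2)
      + 3 / 8 * (cos x ^+ 2 - sin x ^+ 2)
      + (cos x ^+ 4 - 3 * sin x ^+ 2 * cos x ^+ 2) / 4.
    by rewrite cs (_ : sin x ^+ 2 = 1 - cos x ^+ 2); [field|rewrite -cs; ring].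
  by rewrite cs; field.
- apply: continuous_subspaceT => x.
  by apply/differentiable_continuous/derivable1_diffP; exact: ex_derive.
- by congr EFin; rewrite sinN cosN sin_pihalf cos_pihalf; field.
Qed.

(** Substitution x = a + s * sin t. The natural primitive involves the arcsine,
    which is singular at the end points; the substitution avoids it. *)
Lemma integral_halfcircle3 (a s k : R) : 0 < s -> 0 < k ->
  (\int[mu]_x (Num.sqrt (k * (s ^+ 2 - (x - a) ^+ 2)) ^+ 3)%:E
   = (3 / 8 * pi * s ^+ 4 * Num.sqrt k ^+ 3)%:E)%E.
Proof.
move=> s0 k0.
have pi0 := pi_gt0 R.
pose F t : R := a + s * sin t.
have F1 (t : R) : is_derive t 1 F (s * cos t).
  by apply: is_derive_eq; rewrite /GRing.scale/= add0r mul1r.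
have F1E : derive1 F = (fun t => s * cos t).
  by apply/funext => t; rewrite derive1E derive_val.
have cF : continuous F.
  by move=> t; apply/differentiable_continuous/derivable1_diffP; exact: ex_derive.
have cF' : continuous (derive1 F).
  rewrite F1E => t.
  by apply/differentiable_continuous/derivable1_diffP; exact: ex_derive.
have Fa : F (- (pi / 2)) = a - s by rewrite /F sinN sin_pihalf mulrN1.
have Fb : F (pi / 2) = a + s by rewrite /F sin_pihalf mulr1.
pose G x : R := Num.sqrt (k * (s ^+ 2 - (x - a) ^+ 2)) ^+ 3.
transitivity (\int[mu]_(x in `[F (- (pi / 2))%R, F (pi / 2)%R]) (G x)%:E)%E.
  rewrite [RHS]integral_mkcond; apply: eq_integral => x _; rewrite patchE.
  case: ifPn => //; rewrite ?notin_setE/= in_itv/= Fa Fb => xs.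
  rewrite ler0_sqrtr ?expr0n// pmulr_rle0//.
  have [?|?] := ltP x (a - s); first by nra.
  have [?|?] := ltP (a + s) x; first by nra.
  by exfalso; apply: xs; lra.
rewrite integration_by_substitution_increasing//.
- transitivity (\int[mu]_(t in `[(- (pi / 2))%R, (pi / 2)%R])
     ((s ^+ 4 * Num.sqrt k ^+ 3)%:E * (cos t ^+ 4)%:E))%E.
    apply: eq_integral => t; rewrite inE/= in_itv/= => tpi.
    rewrite -EFinM; congr EFin; rewrite F1E fctE /= /G /F.
    have -> : k * (s ^+ 2 - (a + s * sin t - a) ^+ 2) = k * (s * cos t) ^+ 2.
      by rewrite exprMn cos2sin2; ring.
    rewrite sqrtrM ?ltW// sqrtr_sqr ger0_norm; last first.
      by rewrite mulr_ge0 ?(ltW s0)// cos_ge0_pihalf.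
    ring.
  rewrite ge0_integralZl//.
  + rewrite integral_cos4 -EFinM; congr EFin; ring.
  + apply/measurable_EFinP; apply: measurable_funTS.
    apply: continuous_measurable_fun => x.
    by apply/differentiable_continuous/derivable1_diffP; exact: ex_derive.
  + by move=> t _; rewrite lee_fin exprn_even_ge0.
  + by rewrite lee_fin mulr_ge0// exprn_ge0// ltW.
- lra.
- move=> x y; rewrite !in_itv/= => /andP[xpi _] /andP[_ ypi] xy.
  apply: (@gtr0_derive1_incr _ F (- (pi / 2)) (pi / 2)) => //.
  + move=> t; rewrite in_itv/= => tpi.
    by rewrite F1E mulr_gt0// cos_gt0_pihalf.
  + exact: continuous_subspaceT.
- by apply: (cvgP (derive1 F (- (pi / 2)))); apply: cvg_at_right_filter; exact: cF'.
- by apply: (cvgP (derive1 F (pi / 2))); apply: cvg_at_left_filter; exact: cF'.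
- split => [t _| |]; first by have [] := F1 t.
  + by apply: cvg_at_right_filter; exact: cF.
  + by apply: cvg_at_left_filter; exact: cF.
- apply: continuous_subspaceT => x.
  have cS : {for x, continuous (fun x => Num.sqrt (k * (s ^+ 2 - (x - a) ^+ 2)))}.
    apply: continuous_comp; last exact: sqrt_continuous.
    by apply/differentiable_continuous/derivable1_diffP; exact: ex_derive.
  exact: (continuous_comp cS (@exprn_continuous R 3 _)).
Qed.

(** A paraboloid cap over the ellipse where the quadratic form is less than d. On
    each vertical line it is the cap of a parabola, translated by the shear m. *)
Lemma integral_elliptic_bump (m p a b d : R) : 0 < p -> 0 < d ->
  (\int[mu2]_z (Num.max 0 (d - ((z.2 - b + m * (z.1 - a)) ^+ 2
                 + p ^+ 2 * (z.1 - a) ^+ 2)))%:E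
    = (pi * d ^+ 2 / (2 * p))%:E)%E.
Proof.
move=> p0 d0.
rewrite fubini_tonelli1/=; last 2 first.
- apply/measurable_EFinP; apply: measurable_maxr => //.
  apply: measurable_funB => //; apply: measurable_funD.
  + apply: measurable_funX; apply: measurable_funD.
      by apply: measurable_funB => //; exact: measurable_snd.
    by apply: measurable_funM => //; apply: measurable_funB => //; exact: measurable_fst.
  + apply: measurable_funM => //; apply: measurable_funX.
    by apply: measurable_funB => //; exact: measurable_fst.
- by move=> z; rewrite lee_fin le_max lexx.
rewrite /fubini_F/=.
transitivity (\int[mu]_x ((4 / 3)%:E *
    (Num.sqrt (p ^+ 2 * ((Num.sqrt d / p) ^+ 2 - (x - a) ^+ 2)) ^+ 3)%:E))%E.
  apply: eq_integral => x _.
  have -> : p ^+ 2 * ((Num.sqrt d / p) ^+ 2 - (x - a) ^+ 2) = d - p ^+ 2 * (x - a) ^+ 2.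
    rewrite exprMn sqr_sqrtr ?ltW//.
    by have p1 : p != 0 by [rewrite gt_eqF]; field.
  rewrite -EFinM -(integral_parabola _ (b - m * (x - a))).
  by apply: eq_integral => y _; congr EFin; congr Num.max; ring.
rewrite ge0_integralZl//; last first.
- apply/measurable_EFinP; apply: measurable_funX.
  apply: measurableT_comp; first by apply: continuous_measurable_fun; exact: sqrt_continuous.
  apply: measurable_funM => //; apply: measurable_funB => //; apply: measurable_funX.
  exact: measurable_funB.
rewrite integral_halfcircle3 ?divr_gt0 ?sqrtr_gt0 ?exprn_gt0//.
rewrite -EFinM sqrtr_sqr ger0_norm ?ltW//; congr EFin.
have -> : (Num.sqrt d / p) ^+ 4 = d ^+ 2 / p ^+ 4.
  by rewrite exprMn exprVn -[4%N]/(2 * 2)%N exprM sqr_sqrtr ?ltW.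
by have p1 : p != 0 by [rewrite gt_eqF]; field.
Qed.

End PlaneIntegrals.

(** * Directional derivatives *)

Section Directional.
Context {R : realType}.
Implicit Types (g : R * R -> R) (z v : R * R).

(** Reduces a directional derivative in the plane to a derivative on the line,
    for which the chain rule is known. *)
Lemma is_derive_line g z v d :
  is_derive z v g d <-> is_derive (0 : R) 1 (fun t : R => g (z + t *: v)) d.
Proof.
have E : (fun h : R => h^-1 *: ((g \o shift z) (h *: v) - g z)) =
    (fun h : R => h^-1 *: (((fun t : R => g (z + t *: v)) \o shift (0 : R)) (h *: (1 : R))
                           - g (z + (0 : R) *: v))).
  apply/funext => h /=.
  have -> : h *: (1 : R) + 0 = h by rewrite addr0; exact: mulr1.
  by rewrite scale0r addr0 (addrC z).
split=> -[].
- move=> dg <-; split.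
  + by move: dg; rewrite /derivable E.
  + by rewrite /derive E.
- move=> dg <-; split.
  + by move: dg; rewrite /derivable -E.
  + by rewrite /derive -E.
Qed.

Lemma is_derive_compR g z v (h : R -> R) dg dh :
  is_derive z v g dg -> is_derive (g z) 1 h dh -> is_derive z v (h \o g) (dh * dg).
Proof.
move=> /is_derive_line gd hd; apply/is_derive_line.
have hd' : is_derive ((fun t : R => g (z + t *: v)) 0) 1 h dh.
  by rewrite /= scale0r addr0.
exact: (@is_derive1_comp _ h (fun t : R => g (z + t *: v))).
Qed.

Lemma is_derive_fst z v : is_derive z v (fst : R * R -> R) v.1.
Proof.
apply/is_derive_line => /=; apply: is_derive_eq.
by rewrite /GRing.scale/=; ring.
Qed.

Lemma is_derive_snd z v : is_derive z v (snd : R * R -> R) v.2.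
Proof.
apply/is_derive_line => /=; apply: is_derive_eq.
by rewrite /GRing.scale/=; ring.
Qed.

(** The difference quotient at a of the glued function is, for each increment,
    that of f or that of g, and both have the limit d. *)
Lemma is_derive_glue (f g : R -> R) (a d : R) :
  is_derive a 1 f d -> is_derive a 1 g d -> f a = g a ->
  is_derive a 1 (fun t => if t < a then f t else g t) d.
Proof.
move=> [df fd] [dg gd] fga.
set k := fun t => _.
have ka : k a = g a by rewrite /k ltxx.
have cf : h^-1 *: (f (h *: (1 : R) + a) - f a) @[h --> (0:R)^'] --> d.
  by rewrite -fd; exact: df.
have cg : h^-1 *: (g (h *: (1 : R) + a) - g a) @[h --> (0:R)^'] --> d.
  by rewrite -gd; exact: dg.
have ck : h^-1 *: (k (h *: (1 : R) + a) - k a) @[h --> (0:R)^'] --> d.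
  apply/cvgrPdist_le => e e0.
  move/cvgrPdist_le : cf => /(_ e e0) cf; move/cvgrPdist_le : cg => /(_ e e0) cg.
  near=> h; rewrite ka /k; case: ifPn => _.
    by rewrite -fga; near: h.
  by near: h.
split; first by apply/cvg_ex; exists d.
by apply/cvg_lim.
Unshelve. all: by end_near. Qed.

(** The inverse, replaced on t < d by its tangent line at d; this makes it of
    class C1 on the whole line, with derivative -1 / (max d t)^2. *)
Definition cutinv (d t : R) : R := if t < d then (2 * d - t) / d ^+ 2 else t^-1.

Lemma is_derive_cutinv (d t : R) : 0 < d ->
  is_derive t 1 (cutinv d) (- (Num.max d t) ^- 2).
Proof.
move=> d0; have dn0 : d != 0 by rewrite gt_eqF.
have lin (s : R) : is_derive s 1 (fun t => (2 * d - t) / d ^+ 2) (- d ^- 2).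
  by apply: is_derive_eq; rewrite /GRing.scale/=; field.
have inv (s : R) : s != 0 -> is_derive s 1 (fun t : R => t^-1) (- s ^- 2).
  move=> s0; split; first exact: derivableV.
  by rewrite deriveV// derive_id /GRing.scale/= mulr1.
case: (ltgtP t d) => [td|dt|->].
- apply: near_eq_is_derive (lin t).
  near=> s; rewrite /cutinv ifT//; near: s; exact: lt_nbhsl.
- apply: near_eq_is_derive (inv t _); last by rewrite gt_eqF// (lt_trans d0).
  near=> s; rewrite /cutinv ifF//; apply/negbTE; rewrite -leNgt ltW//.
  near: s; exact: lt_nbhsr.
- apply: is_derive_glue; last by field.
  exact: inv.
Unshelve. all: by end_near. Qed.

End Directional.

(** * Continuous differentiability up to the boundary *)

Section C1with.
Context {R : realType}.
Implicit Types (D : set (R * R)) (g gx gy h hx hy : R * R -> R).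

(** C1_closure with the extensions of the partial derivatives to the closure
    given explicitly, which makes sums, products and compositions computable. *)
Definition C1_with D g gx gy : Prop :=
  [/\ {within closure D, continuous g},
      forall z, D z -> is_derive z ((1, 0) : R * R) g (gx z) /\
                       is_derive z ((0, 1) : R * R) g (gy z),
      {within closure D, continuous gx} &
      {within closure D, continuous gy}].

Lemma within_continuousD D g h : {within D, continuous g} ->
  {within D, continuous h} -> {within D, continuous (fun z => g z + h z)}.
Proof. by move=> cg ch x; apply: continuousD; [exact: cg|exact: ch]. Qed.

Lemma within_continuousM D g h : {within D, continuous g} ->
  {within D, continuous h} -> {within D, continuous (fun z => g z * h z)}.
Proof. by move=> cg ch x; apply: continuousM; [exact: cg|exact: ch]. Qed.

Lemma within_continuous_comp D g (k : R -> R) : {within D, continuous g} ->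
  continuous k -> {within D, continuous (fun z => k (g z))}.
Proof. by move=> cg ck x; apply: continuous_comp; [exact: cg|exact: ck]. Qed.

Lemma within_continuous_cst D (a : R) : {within D, continuous (fun=> a)}.
Proof. by apply: continuous_subspaceT => x; exact: cst_continuous. Qed.

Lemma continuous_fst : continuous (fst : R * R -> R).
Proof. by move=> z; exact: cvg_fst. Qed.

Lemma continuous_snd : continuous (snd : R * R -> R).
Proof. by move=> z; exact: cvg_snd. Qed.

Lemma C1_closureP D g :
  C1_closure D g <-> exists gx gy, C1_with D g gx gy.
Proof.
split=> [[cg dg [gx [cgx gxE]] [gy [cgy gyE]]]|[gx [gy [cg dg cgx cgy]]]].
- exists gx, gy; split => // z Dz; have [dx dy] := dg z Dz.
  by rewrite gxE// gyE//; split; exact: derivableP.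
- split => //.
  + by move=> z /dg[[? _] [? _]].
  + by exists gx; split => // z /dg[[_ <-] _].
  + by exists gy; split => // z /dg[_ [_ <-]].
Qed.

Lemma C1_with_cst D a : C1_with D (fun=> a) (fun=> 0) (fun=> 0).
Proof.
split; [exact: within_continuous_cst| |exact: within_continuous_cst|
  exact: within_continuous_cst].
by move=> z _; split; exact: is_derive_cst.
Qed.

Lemma C1_with_fst D : C1_with D fst (fun=> 1) (fun=> 0).
Proof.
split; [|move=> z _|exact: within_continuous_cst..].
  by apply: continuous_subspaceT; exact: continuous_fst.
by split; apply: (is_derive_eq (is_derive_fst _ _)).
Qed.

Lemma C1_with_snd D : C1_with D snd (fun=> 0) (fun=> 1).
Proof.
split; [|move=> z _|exact: within_continuous_cst..].
  by apply: continuous_subspaceT; exact: continuous_snd.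
by split; apply: (is_derive_eq (is_derive_snd _ _)).
Qed.

Lemma C1_withD D g gx gy h hx hy :
  C1_with D g gx gy -> C1_with D h hx hy ->
  C1_with D (fun z => g z + h z) (fun z => gx z + hx z) (fun z => gy z + hy z).
Proof.
move=> [cg dg cgx cgy] [ch dh chx chy]; split; try exact: within_continuousD.
by move=> z Dz; have [? ?] := dg z Dz; have [? ?] := dh z Dz; split; exact: is_deriveD.
Qed.

Lemma C1_withM D g gx gy h hx hy :
  C1_with D g gx gy -> C1_with D h hx hy ->
  C1_with D (fun z => g z * h z) (fun z => gx z * h z + g z * hx z)
            (fun z => gy z * h z + g z * hy z).
Proof.
move=> [cg dg cgx cgy] [ch dh chx chy]; split.
- exact: within_continuousM.
- move=> z Dz; have [? ?] := dg z Dz; have [? ?] := dh z Dz.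
  split; apply: (is_derive_eq (is_deriveM _ _));
    by rewrite addrC /GRing.scale/= (mulrC (h z)).
- by apply: within_continuousD; exact: within_continuousM.
- by apply: within_continuousD; exact: within_continuousM.
Qed.

Lemma C1_with_comp D g gx gy (k dk : R -> R) :
  (forall t : R, is_derive t 1 k (dk t)) -> continuous dk ->
  C1_with D g gx gy ->
  C1_with D (fun z => k (g z)) (fun z => dk (g z) * gx z)
            (fun z => dk (g z) * gy z).
Proof.
move=> kd ck [cg dg cgx cgy]; split.
- apply: within_continuous_comp => // t.
  by apply/differentiable_continuous/derivable1_diffP; have [] := kd t.
- by move=> z Dz; have [? ?] := dg z Dz; split; exact: is_derive_compR.
- by apply: within_continuousM => //; exact: within_continuous_comp.
- by apply: within_continuousM => //; exact: within_continuous_comp.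
Qed.

Lemma C1_with_ext D g gx gy h hx hy :
  C1_with D g gx gy -> g = h -> gx = hx -> gy = hy -> C1_with D h hx hy.
Proof. by move=> + <- <- <-. Qed.

End C1with.

Section GC1with.
Context {R : realType} {alpha beta : R}.
Local Notation A := (gcomplex alpha beta).
Implicit Types (D : set (R * R)) (f fx fy g gx gy : R * R -> A).

Definition gC1_with D f fx fy : Prop :=
  C1_with D (@gRe _ _ _ \o f) (@gRe _ _ _ \o fx) (@gRe _ _ _ \o fy) /\
  C1_with D (@gIm _ _ _ \o f) (@gIm _ _ _ \o fx) (@gIm _ _ _ \o fy).

Lemma gC1_closureP D f :
  gC1_closure D f <-> exists fx fy, gC1_with D f fx fy.
Proof.
split=> [[/C1_closureP[ax [ay fa]] /C1_closureP[bx [by_ fb]]]|[fx [fy [fa fb]]]].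
  by exists (fun z => GComplex (ax z) (bx z)), (fun z => GComplex (ay z) (by_ z)).
by split; apply/C1_closureP; do 2 eexists; eassumption.
Qed.

Lemma gC1_with_dbar D f fx fy z : gC1_with D f fx fy -> D z ->
  2 *: dbar f z = fx z + gi * fy z.
Proof.
move=> [[_ da _ _] [_ db _ _]] Dz.
have [[_ ax] [_ ay]] := da z Dz; have [[_ bx] [_ by_]] := db z Dz.
rewrite /dbar scalerA divff ?pnatr_eq0// scale1r /gpartial_x /gpartial_y.
rewrite /partial_x /partial_y ax ay bx by_ /=.
by case: (fx z) (fy z) => ? ? [].
Qed.

(** The Leibniz rule in the algebra; as multiplication is commutative and i is a
    constant, it makes dbar a derivation. *)
Lemma gC1_withM D f fx fy g gx gy : gC1_with D f fx fy -> gC1_with D g gx gy ->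
  gC1_with D (fun z => f z * g z) (fun z => fx z * g z + f z * gx z)
             (fun z => fy z * g z + f z * gy z).
Proof.
move=> [fa fb] [ga gb]; split.
- have := C1_withD (C1_withM fa ga)
    (C1_withM (C1_with_cst D (- alpha)) (C1_withM fb gb)).
  move=> /C1_with_ext; apply; apply/funext => z /=; ring.
- have := C1_withD (C1_withD (C1_withM fa gb) (C1_withM fb ga))
    (C1_withM (C1_with_cst D (- beta)) (C1_withM fb gb)).
  move=> /C1_with_ext; apply; apply/funext => z /=; ring.
Qed.

End GC1with.

(** * The truncated Cauchy kernel *)

Section Kernel.
Context {R : realType} (alpha beta : R) (zeta : R * R).
Local Notation A := (gcomplex alpha beta).

Definition tilde_diff (z : R * R) : A := gtilde (gof_pair z - gof_pair zeta).

Definition gconj (z : A) : A := GComplex (gRe z - beta * gIm z) (- gIm z).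

Lemma tilde_diffE z : tilde_diff z = GComplex (z.2 - zeta.2) (- (z.1 - zeta.1)).
Proof. by []. Qed.

(** The form y^2 + beta x y + alpha x^2 in the coordinates of z - zeta. *)
Definition quad (z : R * R) : R := Defs.gnorm (tilde_diff z).

Definition cutker (d : R) (z : R * R) : A :=
  cutinv d (quad z) *: gconj (tilde_diff z).

(** The radial profile of dbar (cutker d): with h = cutinv d, it is the function
    h q + q * h' q. *)
Definition mollifier (d : R) (z : R * R) : R := 2 / d ^+ 2 * Num.max 0 (d - quad z).

Lemma quadE z : quad z = (z.2 - zeta.2 + beta / 2 * (z.1 - zeta.1)) ^+ 2
  + (4 * alpha - beta ^+ 2) / 4 * (z.1 - zeta.1) ^+ 2.
Proof. by rewrite /quad tilde_diffE /Defs.gnorm /=; field. Qed.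

Lemma cutinv_mollifier (d t : R) : 0 < d ->
  cutinv d t - t * (Num.max d t) ^- 2 = 2 / d ^+ 2 * Num.max 0 (d - t).
Proof.
move=> d0; rewrite /cutinv; case: (ltP t d) => td.
  rewrite max_r ?subr_ge0 ?ltW//.
  by have d1 : d != 0 by [rewrite gt_eqF]; field.
rewrite max_l ?subr_le0// mulr0.
by have t1 : t != 0 by [rewrite gt_eqF// (lt_le_trans d0)]; field.
Qed.

Lemma quad_C1 (D : set (R * R)) : C1_with D quad
  (fun z => beta * (z.2 - zeta.2) + 2 * alpha * (z.1 - zeta.1))
  (fun z => 2 * (z.2 - zeta.2) + beta * (z.1 - zeta.1)).
Proof.
have X := C1_withD (C1_with_fst D) (C1_with_cst D (- zeta.1)).
have Y := C1_withD (C1_with_snd D) (C1_with_cst D (- zeta.2)).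
have bX := C1_withM (C1_with_cst D beta) X.
have := C1_withD (C1_withD (C1_withM Y Y) (C1_withM Y bX))
                 (C1_withM (C1_with_cst D alpha) (C1_withM X X)).
move/C1_with_ext; apply; apply/funext => z; [|ring|ring].
by rewrite /quad tilde_diffE /Defs.gnorm /=; ring.
Qed.

(** With w the tilde of z - zeta, 2 dbar (h q *: conj w) is the sum of
    h q *: (2 dbar (conj w)) and h' q *: (2 dbar q * conj w). Here
    2 dbar (conj w) = beta + 2 i, and q = w * conj w with dbar w = 0, so that
    2 dbar q * conj w = q *: (beta + 2 i). *)
Lemma cutker_C1 (d : R) (D : set (R * R)) : 0 < d -> exists kx ky,
  gC1_with D (cutker d) kx ky /\
  forall z, kx z + gi * ky z = mollifier d z *: (GComplex beta 2 : A).
Proof.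
move=> d0.
have X := C1_withD (C1_with_fst D) (C1_with_cst D (- zeta.1)).
have Y := C1_withD (C1_with_snd D) (C1_with_cst D (- zeta.2)).
have bX := C1_withM (C1_with_cst D beta) X.
have cH : continuous (fun t => - (Num.max d t) ^- 2 : R).
  move=> t; apply: cvgN; apply: cvgV.
    by rewrite expf_neq0// gt_eqF// lt_max d0.
  have cM : {for t, continuous (Num.max d)}.
    by apply: (@continuous_max _ _ (fun=> d) id); [exact: cst_continuous|exact: cvg_id].
  exact: (continuous_comp cM (@exprn_continuous R 2 _)).
have H := C1_with_comp (fun t => is_derive_cutinv t d0) cH (quad_C1 D).
have K1 := C1_withM H (C1_withD Y bX).
have K2 := C1_withM H X.
pose h' z : R := - (Num.max d (quad z)) ^- 2.
pose qx z := beta * (z.2 - zeta.2) + 2 * alpha * (z.1 - zeta.1).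
pose qy z := 2 * (z.2 - zeta.2) + beta * (z.1 - zeta.1).
exists (fun z => GComplex
    (h' z * qx z * (z.2 - zeta.2 + beta * (z.1 - zeta.1)) + cutinv d (quad z) * beta)
    (h' z * qx z * (z.1 - zeta.1) + cutinv d (quad z))).
exists (fun z => GComplex
    (h' z * qy z * (z.2 - zeta.2 + beta * (z.1 - zeta.1)) + cutinv d (quad z))
    (h' z * qy z * (z.1 - zeta.1))).
split=> [|z]; first split.
- apply: (C1_with_ext K1); apply/funext => z; rewrite /h' /qx /qy /=; ring.
- apply: (C1_with_ext K2); apply/funext => z; rewrite /h' /qx /qy /=; ring.
- rewrite /mollifier -cutinv_mollifier// -/(h' z).
  have -> : cutinv d (quad z) - quad z / Num.max d (quad z) ^+ 2 =
      cutinv d (quad z) + ((z.2 - zeta.2) ^+ 2 + beta * (z.1 - zeta.1) * (z.2 - zeta.2)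
        + alpha * (z.1 - zeta.1) ^+ 2) * h' z.
    rewrite /h' mulrN; congr (_ - _ / _).
    by rewrite /quad tilde_diffE /Defs.gnorm /=; ring.
  by congr GComplex => /=; rewrite /qx /qy; ring.
Qed.

End Kernel.

Lemma within_continuous_eq (R : realType) (D : set (R * R)) (g h : R * R -> R) :
  {within D, continuous g} -> g = h -> {within D, continuous h}.
Proof. by move=> + <-. Qed.

(** * Integrability on bounded plane sets *)

Section PlaneIntegrability.
Context {R : realType}.
Local Notation mu2 := (@lebesgue_measure R \x @lebesgue_measure R)%E.
Implicit Types (D : set (R * R)) (g : R * R -> R).

Definition box (p : R * R) (r : R) : set (R * R) :=
  `[p.1 - r, p.1 + r] `*` `[p.2 - r, p.2 + r].

Lemma boxP p r z : box p r z <-> `|z.1 - p.1| <= r /\ `|z.2 - p.2| <= r.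
Proof. by rewrite /box /= !in_itv/= !ler_distl; split=> [[-> ->]|[]]. Qed.

Lemma measurable_box p r : measurable (box p r).
Proof. exact: measurableX. Qed.

Lemma measurable_invsqrt2 (p : R * R) D : measurable D ->
  measurable_fun D (fun z => invsqrt p.1 z.1 * invsqrt p.2 z.2)%E.
Proof.
move=> mD; apply: measurable_funTS; apply: emeasurable_funM.
- have m1 : measurable_fun setT (invsqrt p.1) by exact: measurable_invsqrt.
  exact: (measurableT_comp m1 measurable_fst).
- have m2 : measurable_fun setT (invsqrt p.2) by exact: measurable_invsqrt.
  exact: (measurableT_comp m2 measurable_snd).
Qed.

(** The same bound serves twice: on a large box it gives the integrability of the
    Cauchy kernel, on a small one the negligibility of the region near zeta. *)
Lemma singular_integral_bound D g p C r : measurable D -> measurable_fun D g ->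
  0 <= C -> 0 < r ->
  (forall z, D z -> (`|g z|%:E <= C%:E * (invsqrt p.1 z.1 * invsqrt p.2 z.2))%E) ->
  (forall z, D z -> g z != 0 -> box p r z) ->
  mu2.-integrable D (EFin \o g) /\
  `|\int[mu2]_(z in D) g z| <= C * (16 * r).
Proof.
move=> mD mg C0 r0 gC gr.
pose psi (z : R * R) := (invsqrt p.1 z.1 * invsqrt p.2 z.2)%E.
have psi0 z : (0 <= psi z)%E by rewrite mule_ge0 ?invsqrt_ge0.
have bnd : (\int[mu2]_(z in D) `|(g z)%:E| <= (C * (16 * r))%:E)%E.
  apply: (@le_trans _ _ (\int[mu2]_(z in box p r) (C%:E * psi z)))%E; last first.
    rewrite ge0_integralZl//; last 2 first.
    - exact: measurable_box.
    - exact: (measurable_invsqrt2 _ (measurable_box p r)).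
    rewrite EFinM lee_wpmul2l ?lee_fin//.
    exact: integral_invsqrt2.
  rewrite [leLHS]integral_mkcond [leRHS]integral_mkcond.
  apply: ge0_le_integral => //.
  - by move=> z _; rewrite patchE; case: ifPn.
  - apply/(measurable_restrictT (fun z => `|(g z)%:E|%E) mD).
    by apply: measurableT_comp => //; exact/measurable_EFinP.
  - apply/(measurable_restrictT (fun z => C%:E * psi z)%E (measurable_box p r)).
    apply: measurable_funeM; exact: (measurable_invsqrt2 _ (measurable_box p r)).
  - move=> z _; rewrite !patchE; case: ifPn => zD; last first.
      by case: ifPn => // _; rewrite mule_ge0.
    rewrite inE in zD; have [g0|g0] := eqVneq (g z) 0.
      by rewrite g0 abse0; case: ifPn => // _; rewrite mule_ge0.
    by rewrite mem_set; [exact: gC|exact: gr].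
have ig : mu2.-integrable D (EFin \o g).
  apply/integrableP; split; first exact/measurable_EFinP.
  exact: le_lt_trans bnd (ltry _).
split=> //; rewrite -lee_fin EFin_normr_Rintegral//.
by apply: le_trans bnd; apply: le_abse_integral => //; exact/measurable_EFinP.
Qed.

Lemma bounded_box D (p : R * R) : bounded_set D ->
  exists2 r, 0 < r & D `<=` box p r.
Proof.
move=> /pinfty_ex_gt0 [M M0 DM]; exists (M + `|p|); first by rewrite ltr_wpDr.
move=> z /DM /=; rewrite !prod_normE /= => zM.
have z1 : `|z.1| <= M by apply: le_trans zM; rewrite le_max lexx.
have z2 : `|z.2| <= M by apply: le_trans zM; rewrite le_max lexx orbT.
apply/boxP; split; rewrite (le_trans (ler_normB _ _))// lerD//.
  by rewrite le_max lexx.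
by rewrite le_max lexx orbT.
Qed.

Lemma bounded_finite_measure D : measurable D -> bounded_set D -> (mu2 D < +oo)%E.
Proof.
move=> mD /(bounded_box (0, 0))[r r0 Dr].
apply: (@le_lt_trans _ _ (mu2 (box (0, 0) r))).
  by apply: le_measure; rewrite ?inE//; exact: measurable_box.
rewrite /box product_measure1E//= lebesgue_measure_itv/=.
  do 2?[case: ifPn => _]; rewrite ?mule0 ?mul0e ?ltry//.
Qed.

Lemma within_closure_integrable D g : open D -> bounded_set D ->
  {within closure D, continuous g} -> mu2.-integrable D (EFin \o g).
Proof.
move=> oD bD cg; have mD := open_measurable2 oD.
apply: measurable_bounded_integrable => //.
- exact: bounded_finite_measure.
- apply: within_continuous_measurable2 => //.
  by apply: continuous_subspaceW cg; exact: subset_closure.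
- have [M gM] := within_closure_bounded bD cg.
  exists M; split; rewrite ?num_real// => x Mx z Dz /=.
  by apply: le_trans (ltW Mx); apply: gM; exact: subset_closure.
Qed.

End PlaneIntegrability.

(** * Integration of algebra-valued functions *)

Section GIntegral.
Context {R : realType} {alpha beta : R}.
Local Notation A := (gcomplex alpha beta).
Local Notation mu2 := (@lebesgue_measure R \x @lebesgue_measure R)%E.
Local Notation plane := (measurableTypeR R * measurableTypeR R)%type.
Implicit Types (D : set plane) (f g : R * R -> A) (c : A).

Definition gintegrable D f : Prop :=
  mu2.-integrable D (EFin \o (@gRe _ _ _ \o f)) /\
  mu2.-integrable D (EFin \o (@gIm _ _ _ \o f)).

Lemma eq_garea_integral D f g : {in D, f =1 g} ->
  garea_integral D f = garea_integral D g.
Proof. by move=> fg; congr GComplex; apply: eq_Rintegral => z /fg ->. Qed.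

Lemma garea_integralD D f g : measurable D -> gintegrable D f -> gintegrable D g ->
  garea_integral D (fun z => f z + g z) = garea_integral D f + garea_integral D g.
Proof.
by move=> mD [fr fi] [gr gi]; congr GComplex; rewrite /= RintegralD.
Qed.

Lemma garea_integralB D f g : measurable D -> gintegrable D f -> gintegrable D g ->
  garea_integral D (fun z => f z - g z) = garea_integral D f - garea_integral D g.
Proof.
by move=> mD [fr fi] [gr gi]; congr GComplex; rewrite /= RintegralB.
Qed.

Lemma gintegrableMl D c f : measurable D -> gintegrable D f ->
  gintegrable D (fun z => c * f z).
Proof.
move=> mD [fr fi]; split.
- have := integrableB mD (integrableZl mD (gRe c) fr)
                         (integrableZl mD (alpha * gIm c) fi).
  by apply: eq_integrable.
- have := integrableB mD (integrableD mD (integrableZl mD (gRe c) fi)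
     (integrableZl mD (gIm c) fr)) (integrableZl mD (beta * gIm c) fi).
  by apply: eq_integrable.
Qed.

Lemma garea_integralMl D c f : measurable D -> gintegrable D f ->
  garea_integral D (fun z => c * f z) = c * garea_integral D f.
Proof.
move=> mD [fr fi].
have Z k (h : R * R -> R) : mu2.-integrable D (EFin \o h) ->
    mu2.-integrable D (EFin \o (fun z => k * h z)).
  by move=> /(integrableZl mD k); apply: eq_integrable.
congr GComplex => /=.
- rewrite RintegralB; [|by []|exact: Z..].
  by rewrite !RintegralZl.
- rewrite RintegralB; [|by []| |exact: Z].
    by rewrite RintegralD; [|by []|exact: Z..]; rewrite !RintegralZl.
  by have := integrableD mD (Z (gRe c) _ fi) (Z (gIm c) _ fr); apply: eq_integrable.
Qed.

Definition gcont D f : Prop :=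
  {within D, continuous (@gRe _ _ _ \o f)} /\
  {within D, continuous (@gIm _ _ _ \o f)}.

Lemma gcont_cst D c : gcont D (fun=> c).
Proof. by split; exact: within_continuous_cst. Qed.

Lemma gcontD D f g : gcont D f -> gcont D g -> gcont D (fun z => f z + g z).
Proof. by move=> [? ?] [? ?]; split; exact: within_continuousD. Qed.

Lemma gcontM D f g : gcont D f -> gcont D g -> gcont D (fun z => f z * g z).
Proof.
move=> [fr fi] [gr gi]; split.
- have := within_continuousD (within_continuousM fr gr)
    (within_continuousM (@within_continuous_cst _ D (- alpha))
       (within_continuousM fi gi)).
  move=> /within_continuous_eq; apply; apply/funext => z; rewrite ?fctE /=; ring.
- have := within_continuousD
    (within_continuousD (within_continuousM fr gi) (within_continuousM fi gr))
    (within_continuousM (@within_continuous_cst _ D (- beta))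
       (within_continuousM fi gi)).
  move=> /within_continuous_eq; apply; apply/funext => z; rewrite ?fctE /=; ring.
Qed.

Lemma gcont_gintegrable D f : open D -> bounded_set D -> gcont (closure D) f ->
  gintegrable D f.
Proof. by move=> oD bD [fr fi]; split; exact: within_closure_integrable. Qed.

Lemma gC1_with_gcont D f fx fy : gC1_with D f fx fy ->
  [/\ gcont (closure D) f, gcont (closure D) fx & gcont (closure D) fy].
Proof. by move=> [[? _ ? ?] [? _ ? ?]]; split. Qed.

(** The Green-Gauss formulas for the two real components of f, recombined. Only
    area integrals are split into sums, their integrands being bounded; the line
    integrals of single components occur on both sides as they stand. *)
Lemma green_dtilde D (gam : R -> R * R) f fx fy :
  open (D : set (R * R)) -> bounded_set (D : set (R * R)) -> green_gauss D gam ->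
  gC1_with D f fx fy ->
  gline_integral_dtilde gam f = garea_integral D (fun z => fx z + gi * fy z).
Proof.
move=> oD bD GG ff; have mD : measurable D by exact: open_measurable2.
have [_ cfx cfy] := gC1_with_gcont ff.
have ifx := gcont_gintegrable oD bD cfx; have ify := gcont_gintegrable oD bD cfy.
rewrite garea_integralD//; last exact: gintegrableMl.
rewrite garea_integralMl// /gline_integral_dtilde.
have G (g gx gy : R * R -> R) : C1_with D g gx gy ->
    line_integral_dy gam g = \int[mu2]_(z in D) gx z /\
    line_integral_dx gam g = - \int[mu2]_(z in D) gy z.
  move=> gg; have [Ex Ey] := GG g ((C1_closureP D g).2 (ex_intro _ gx (ex_intro _ gy gg))).
  case: gg => _ dg _ _; split.
    rewrite -Ex; apply: eq_Rintegral => z; rewrite inE => /dg[[_ +] _].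
    by rewrite /partial_x => ->.
  rewrite -[LHS]opprK -Ey; congr (- _); apply: eq_Rintegral => z.
  by rewrite inE => /dg[_ [_]]; rewrite /partial_y => ->.
case: ff => /G[ax ay] /G[bx by_].
rewrite /gline_integral_dy /gline_integral_dx ax ay bx by_.
congr (_ + _); rewrite -mulrN; congr (_ * _).
by congr GComplex; rewrite opprK.
Qed.

(** A norm on the algebra; it is submultiplicative up to a constant only. *)
Definition gsize (a : A) : R := `|gRe a| + `|gIm a|.

Lemma gsizeM (a b : A) :
  gsize (a * b) <= (1 + `|alpha| + `|beta|) * gsize a * gsize b.
Proof.
case: a b => a1 a2 [b1 b2]; rewrite /gsize /=.
have T1 : `|a1 * b1 - alpha * a2 * b2| <= `|a1| * `|b1| + `|alpha| * `|a2| * `|b2|.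
  by rewrite (le_trans (ler_normB _ _))// !normrM.
have T2 : `|a1 * b2 + a2 * b1 - beta * a2 * b2| <=
    `|a1| * `|b2| + `|a2| * `|b1| + `|beta| * `|a2| * `|b2|.
  rewrite (le_trans (ler_normB _ _))// !normrM lerD2r.
  by rewrite (le_trans (ler_normD _ _))// !normrM.
apply: le_trans (lerD T1 T2) _.
have := normr_ge0 a1; have := normr_ge0 a2; have := normr_ge0 b1.
have := normr_ge0 b2; have := normr_ge0 alpha; have := normr_ge0 beta.
set u := `|a1|; set v := `|a2|; set s := `|b1|; set t := `|b2|.
set p := `|alpha|; set q := `|beta| => q0 p0 t0 s0 v0 u0.
rewrite -subr_ge0 (_ : _ - _ = v * t + p * (u * s + u * t + v * s) + q * (u * s + u * t + v * s)); last ring.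
by rewrite !(addr_ge0, mulr_ge0).
Qed.

Lemma gsize_ge0 (a : A) : 0 <= gsize a.
Proof. by rewrite addr_ge0. Qed.

Lemma gsize_Re (a : A) : `|gRe a| <= gsize a.
Proof. by rewrite lerDl. Qed.

Lemma gsize_Im (a : A) : `|gIm a| <= gsize a.
Proof. by rewrite lerDr. Qed.

Lemma gsizeD (a b : A) : gsize (a + b) <= gsize a + gsize b.
Proof.
by rewrite /gsize addrACA lerD//= ler_normD.
Qed.

Lemma gsize_eq0 (a : A) : (forall e, 0 < e -> gsize a <= e) -> a = 0.
Proof.
move=> ae; have : gsize a <= 0.
  by apply/ler_addgt0Pr => e e0; rewrite add0r; exact: ae.
rewrite le_eqVlt ltNge gsize_ge0 orbF paddr_eq0// !normr_eq0 => /andP[/eqP a1 /eqP a2].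
by case: a a1 a2 {ae} => ? ? /= -> ->.
Qed.

Definition gmeas D f : Prop :=
  measurable_fun D (@gRe _ _ _ \o f) /\ measurable_fun D (@gIm _ _ _ \o f).

Lemma gmeasM D f g : gmeas D f -> gmeas D g -> gmeas D (fun z => f z * g z).
Proof.
move=> [fr fi] [gr gi']; split.
- apply: measurable_funB; first exact: measurable_funM.
  by apply: measurable_funM => //; exact: measurable_funM.
- apply: measurable_funB.
    by apply: measurable_funD; exact: measurable_funM.
  by apply: measurable_funM => //; exact: measurable_funM.
Qed.

Lemma gmeasB D f g : gmeas D f -> gmeas D g -> gmeas D (fun z => f z - g z).
Proof. by move=> [fr fi] [gr gi']; split; exact: measurable_funB. Qed.

Lemma gcont_gmeas D f : open (D : set (R * R)) -> gcont (closure (D : set (R * R))) f ->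
  gmeas D f.
Proof.
move=> oD [fr fi]; split; apply: within_continuous_measurable2;
  try exact: open_measurable2.
- by apply: continuous_subspaceW fr; exact: subset_closure.
- by apply: continuous_subspaceW fi; exact: subset_closure.
Qed.

Lemma singular_garea_bound D f (p : R * R) (C r : R) : measurable D -> gmeas D f ->
  0 <= C -> 0 < r ->
  (forall z, D z ->
     ((gsize (f z))%:E <= C%:E * (invsqrt p.1 z.1 * invsqrt p.2 z.2))%E) ->
  (forall z, D z -> f z != 0 -> box p r z) ->
  gintegrable D f /\ gsize (garea_integral D f) <= C * (32 * r).
Proof.
move=> mD [mr mi] C0 r0 fC fr.
have [ir br] : mu2.-integrable D (EFin \o (@gRe _ _ _ \o f)) /\
    `|\int[mu2]_(z in D) gRe (f z)| <= C * (16 * r).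
  apply: (singular_integral_bound (p := p)) => // z Dz.
    by apply: le_trans (fC z Dz); rewrite lee_fin gsize_Re.
  by move=> f0; apply: fr => //; apply: contra_neq f0 => /= ->.
have [ii bi] : mu2.-integrable D (EFin \o (@gIm _ _ _ \o f)) /\
    `|\int[mu2]_(z in D) gIm (f z)| <= C * (16 * r).
  apply: (singular_integral_bound (p := p)) => // z Dz.
    by apply: le_trans (fC z Dz); rewrite lee_fin gsize_Im.
  by move=> f0; apply: fr => //; apply: contra_neq f0 => /= ->.
split; first by split.
rewrite /gsize /=; move: br bi; set u := Rintegral _ _ _; set v := Rintegral _ _ _.
by lra.
Qed.

End GIntegral.

(** * The Cauchy kernel in the elliptic case *)

Section EllipticKernel.
Context {R : realType} (alpha beta : R) (zeta : R * R).
Context (elliptic : 0 < 4 * alpha - beta ^+ 2).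
Local Notation A := (gcomplex alpha beta).
Local Notation mu2 := (@lebesgue_measure R \x @lebesgue_measure R)%E.
Local Notation plane := (measurableTypeR R * measurableTypeR R)%type.
Local Notation w := (tilde_diff alpha beta zeta).
Local Notation q := (quad alpha beta zeta).

(** The smaller eigenvalue of the form y^2 + beta x y + alpha x^2 is at least its
    determinant divided by its trace, and this is the constant chosen here. *)
Definition coercivity : R := (4 * alpha - beta ^+ 2) / 4 / (1 + alpha).
Local Notation k := coercivity.

Let alpha_gt0 : 0 < alpha.
Proof. by have := sqr_ge0 beta; move: elliptic; lra. Qed.

Lemma coercivity_gt0 : 0 < k.
Proof. by rewrite !divr_gt0// addr_gt0. Qed.

Lemma quad_coercive z :
  k * ((z.1 - zeta.1) ^+ 2 + (z.2 - zeta.2) ^+ 2) <= q z.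
Proof.
rewrite /q tilde_diffE /Defs.gnorm /=.
set x := z.1 - zeta.1; set y := z.2 - zeta.2.
have a1 : 1 + alpha != 0 by rewrite gt_eqF// addr_gt0.
have k1 : k * (1 + alpha) = alpha - beta ^+ 2 / 4 by rewrite /k; field.
have k_lt1 : 0 < 1 - k.
  rewrite subr_gt0 /k ltr_pdivrMr ?addr_gt0// mul1r.
  by have := sqr_ge0 beta; lra.
(* the determinant of the form q - k (x^2 + y^2) is k^2, hence positive; complete
   the square in y *)
rewrite -subr_ge0 -(pmulr_rge0 _ k_lt1).
rewrite (_ : _ * _ = ((1 - k) * y + beta / 2 * x) ^+ 2
  + (k ^+ 2 + (alpha - beta ^+ 2 / 4) - k * (1 + alpha)) * x ^+ 2); last by field.
rewrite k1 addrK; apply: addr_ge0; first exact: sqr_ge0.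
by rewrite -exprMn sqr_ge0.
Qed.

Lemma quad_ge0 z : 0 <= q z.
Proof.
apply: le_trans (quad_coercive z).
by rewrite mulr_ge0 ?addr_ge0 ?sqr_ge0// ltW ?coercivity_gt0.
Qed.

Lemma quad_eq0 z : q z = 0 -> w z = 0.
Proof.
move=> q0; have := quad_coercive z; rewrite q0 pmulr_rle0 ?coercivity_gt0//.
rewrite le_eqVlt ltNge addr_ge0 ?sqr_ge0// orbF paddr_eq0 ?sqr_ge0//.
by rewrite !sqrf_eq0 tilde_diffE => /andP[/eqP -> /eqP ->]; rewrite oppr0.
Qed.

Lemma quad_box r z : 0 <= r -> q z < k * r ^+ 2 -> box zeta r z.
Proof.
move=> r0 /(le_lt_trans (quad_coercive z)); rewrite ltr_pM2l ?coercivity_gt0// => xyr.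
have sq x : x ^+ 2 <= r ^+ 2 -> `|x| <= r.
  by rewrite -(ler_sqr _ r0) ?nnegrE// real_normK ?num_real.
have := sqr_ge0 (z.1 - zeta.1); have := sqr_ge0 (z.2 - zeta.2) => x0 y0.
by apply/boxP; split; apply: sq; lra.
Qed.

Definition cauchy_kernel (z : R * R) : A := (q z)^-1 *: gconj (w z).

(** At z = zeta both sides vanish, the inverse of 0 being 0. *)
Lemma cauchyE z : (w z)^-1 = cauchy_kernel z.
Proof.
rewrite /cauchy_kernel; change ((w z)^-1) with (ginv (w z)).
rewrite /ginv; case: ifPn => [/eqP q0|_].
  by have := quad_eq0 q0; rewrite /gconj => -> /=; congr GComplex; rewrite /= ?mulr0 ?subr0 ?oppr0 ?mulr0.
by congr GComplex; rewrite /= mulrC.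
Qed.

Definition cauchy_bound : R := (1 + `|beta|) / k.

Lemma cauchy_bound_gt0 : 0 < cauchy_bound.
Proof. by rewrite divr_gt0 ?coercivity_gt0// ltr_pwDl. Qed.

Lemma gsizeZ (a : R) (b : A) : gsize (a *: b) = `|a| * gsize b.
Proof. by rewrite /gsize /= !normrM mulrDr. Qed.

Lemma gsize_gconj z :
  gsize (gconj (w z)) <= (1 + `|beta|) * (`|z.1 - zeta.1| + `|z.2 - zeta.2|).
Proof.
rewrite tilde_diffE /gsize /=.
set x := z.1 - zeta.1; set y := z.2 - zeta.2.
have := ler_normB y (beta * - x); rewrite normrM !normrN => ?.
have : 0 <= `|beta| * `|y| by rewrite mulr_ge0.
lra.
Qed.

(** Up to constants the left-hand side is (|x| + |y|) / (x^2 + y^2). With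
    a^2 = |x| and b^2 = |y| the claim becomes a b (a^2 + b^2) <= a^4 + b^4. *)
Lemma gsize_cauchy z :
  ((gsize (cauchy_kernel z))%:E <=
   cauchy_bound%:E * (invsqrt zeta.1 z.1 * invsqrt zeta.2 z.2))%E.
Proof.
have C0 := cauchy_bound_gt0.
rewrite /invsqrt; case: ifPn => [_|x0].
  rewrite gt0_mulye ?gt0_muley ?lte_fin ?leey//.
  by case: ifPn => // y0; rewrite lte_fin invr_gt0 sqrtr_gt0 normr_gt0 subr_eq0.
case: ifPn => [_|y0].
  rewrite gt0_muley ?gt0_muley ?lte_fin ?leey//.
  by rewrite invr_gt0 sqrtr_gt0 normr_gt0 subr_eq0.
rewrite -subr_eq0 in x0; rewrite -subr_eq0 in y0.
rewrite -!EFinM lee_fin /cauchy_kernel gsizeZ.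
set x := z.1 - zeta.1 in x0 *; set y := z.2 - zeta.2 in y0 *.
have a0 : 0 < Num.sqrt `|x| by rewrite sqrtr_gt0 normr_gt0.
have b0 : 0 < Num.sqrt `|y| by rewrite sqrtr_gt0 normr_gt0.
have ax : `|x| = Num.sqrt `|x| ^+ 2 by rewrite sqr_sqrtr.
have by_ : `|y| = Num.sqrt `|y| ^+ 2 by rewrite sqr_sqrtr.
set a := Num.sqrt `|x| in a0 ax *; set b := Num.sqrt `|y| in b0 by_ *.
have k0 := coercivity_gt0.
have qab : k * (a ^+ 4 + b ^+ 4) <= q z.
  rewrite (_ : a ^+ 4 = x ^+ 2); last by rewrite -real_normK ?num_real// ax -exprM.
  by rewrite (_ : b ^+ 4 = y ^+ 2); [exact: quad_coercive|rewrite -real_normK ?num_real// by_ -exprM].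
have q0 : 0 < q z by apply: lt_le_trans qab; rewrite mulr_gt0// addr_gt0// exprn_gt0.
rewrite [`|_|]ger0_norm; last by rewrite invr_ge0 ltW.
rewrite mulrC ler_pdivrMr//.
apply: le_trans (gsize_gconj z) _; rewrite -/x -/y ax by_.
rewrite /cauchy_bound -!mulrA ler_pM2l ?ltr_pwDl//.
rewrite ler_pdivlMl// mulrCA ler_pdivlMl// mulrCA ler_pdivlMl//.
apply: le_trans qab; rewrite -subr_ge0.
rewrite (_ : _ - _ = k * ((a - b) ^+ 2 * (a ^+ 2 + a * b + b ^+ 2))); last by ring.
have ab0 := ltW (mulr_gt0 a0 b0).
by apply: mulr_ge0; [exact: ltW|rewrite mulr_ge0 ?sqr_ge0// !addr_ge0 ?sqr_ge0].
Qed.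

Local Notation K := (cutker alpha beta zeta).

Lemma cutker_cauchy d z : d <= q z -> K d z = cauchy_kernel z.
Proof. by move=> dq; rewrite /cutker /cutinv ltNge dq. Qed.

(** The tangent line lies below the graph of the convex function t^-1 and is
    positive on t < d, so truncation never moves the kernel by more than its own
    size. *)
Lemma gsize_cutkerB d z : 0 < d -> gsize (K d z - cauchy_kernel z) <= gsize (cauchy_kernel z).
Proof.
move=> d0; have [/quad_eq0 w0|q0] := eqVneq (q z) 0.
  rewrite /cutker /cauchy_kernel w0 (_ : gconj 0 = 0) ?scaler0 ?subrr//.
  by rewrite /gconj; congr GComplex => /=; rewrite ?mulr0 ?oppr0 ?addr0.
have {}q0 : 0 < q z by rewrite lt_neqAle eq_sym q0 quad_ge0.
rewrite /cutker /cauchy_kernel -scalerBl !gsizeZ ler_wpM2r ?gsize_ge0//.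
have qi : 0 <= (q z)^-1 by rewrite invr_ge0 ltW.
rewrite [leRHS]ger0_norm// /cutinv; case: ifPn => qd; last first.
  by rewrite subrr normr0.
have qn0 : q z != 0 by rewrite gt_eqF.
have dn0 : d != 0 by rewrite gt_eqF.
have -> : (2 * d - q z) / d ^+ 2 - (q z)^-1 = - ((d - q z) / d) ^+ 2 * (q z)^-1.
  by field; rewrite qn0.
rewrite normrM normrN [X in _ * X]ger0_norm// ler_piMl// ger0_norm ?sqr_ge0// exprn_ile1//.
  by apply: divr_ge0; rewrite ?subr_ge0 ltW.
by rewrite ler_pdivrMr// mul1r gerBl ltW.
Qed.

Lemma measurable_quad : measurable_fun setT (q : plane -> R).
Proof.
have m1 : measurable_fun setT (fun z : plane => z.1 - zeta.1).
  by apply: measurable_funB => //; exact: measurable_fst.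
have m2 : measurable_fun setT (fun z : plane => z.2 - zeta.2).
  by apply: measurable_funB => //; exact: measurable_snd.
rewrite (_ : q = (fun z => (z.2 - zeta.2 + beta / 2 * (z.1 - zeta.1)) ^+ 2
  + (4 * alpha - beta ^+ 2) / 4 * (z.1 - zeta.1) ^+ 2)); last first.
  by apply/funext => z; exact: quadE.
apply: measurable_funD.
  by apply: measurable_funX; apply: measurable_funD => //; exact: measurable_funM.
by apply: measurable_funM => //; exact: measurable_funX.
Qed.

Lemma gmeas_cauchy (D : set plane) : gmeas D cauchy_kernel.
Proof.
have mq : measurable_fun setT (fun z : plane => (q z)^-1).
  (* the inverse coincides with a real power on nonnegative numbers *)
  rewrite (_ : (fun z => _) = (@powR R ^~ (- 1)) \o q).
    by apply: measurableT_comp; [exact: measurable_powR|exact: measurable_quad].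
  by apply/funext => z /=; rewrite powR_inv1 ?quad_ge0.
have m1 : measurable_fun setT (fun z : plane => z.1 - zeta.1).
  by apply: measurable_funB => //; exact: measurable_fst.
have m2 : measurable_fun setT (fun z : plane => z.2 - zeta.2).
  by apply: measurable_funB => //; exact: measurable_snd.
split; apply: measurable_funTS; apply: measurable_funM => //.
- apply: measurable_funB => //; apply: measurable_funM => //.
  by apply: measurableT_comp.
- rewrite (_ : (fun z => _) = (fun z : plane => z.1 - zeta.1))//.
  by apply/funext => z /=; rewrite opprK.
Qed.

Local Notation B := (mollifier alpha beta zeta).

Lemma mollifier_box (r : R) z : 0 <= r -> B (k * r ^+ 2) z != 0 -> box zeta r z.
Proof.
move=> r0 Bz; apply: quad_box => //; rewrite ltNge; apply: contra Bz => dq.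
by rewrite /mollifier max_l ?subr_le0// mulr0.
Qed.

Lemma mollifier_ge0 d z : 0 <= B d z.
Proof. by rewrite mulr_ge0 ?divr_ge0 ?sqr_ge0// le_max lexx. Qed.

Lemma measurable_mollifier d (D : set plane) : measurable_fun D (B d).
Proof.
apply: measurable_funTS; apply: measurable_funM => //.
apply: measurable_maxr => //; apply: measurable_funB => //; exact: measurable_quad.
Qed.

Definition mollifier_mass : R := 2 * pi / Num.sqrt (4 * alpha - beta ^+ 2).

Lemma integral_mollifier d (D : set plane) : 0 < d -> measurable D ->
  (forall z, B d z != 0 -> D z) ->
  (\int[mu2]_(z in D) (B d z)%:E = mollifier_mass%:E)%E.
Proof.
move=> d0 mD BD; set s := Num.sqrt (4 * alpha - beta ^+ 2).
have s0 : 0 < s by rewrite sqrtr_gt0.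
have sE : 4 * alpha - beta ^+ 2 = s ^+ 2 by rewrite sqr_sqrtr// ltW.
have -> : (\int[mu2]_(z in D) (B d z)%:E =
    \int[mu2]_z ((2 / d ^+ 2)%:E * (Num.max 0 (d - q z))%:E))%E.
  rewrite integral_mkcond; apply: eq_integral => z _.
  rewrite patchE -EFinM; case: ifPn => //; rewrite notin_setE => nD; congr EFin.
  by apply/esym/eqP/negPn/negP => /BD.
rewrite ge0_integralZl//.
- rewrite (_ : (fun z => _) = (fun z => (Num.max 0 (d -
      ((z.2 - zeta.2 + beta / 2 * (z.1 - zeta.1)) ^+ 2
       + (s / 2) ^+ 2 * (z.1 - zeta.1) ^+ 2)))%:E)); last first.
    apply/funext => z; rewrite quadE sE.
    by rewrite expr_div_n -natrX.
  rewrite integral_elliptic_bump ?divr_gt0// -EFinM; congr EFin.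
  rewrite /mollifier_mass -/s.
  have sn0 : s != 0 by rewrite gt_eqF.
  have dn0 : d != 0 by rewrite gt_eqF.
  by field; rewrite ?sn0 ?dn0.
- apply/measurable_EFinP; apply: measurable_maxr => //.
  by apply: measurable_funB => //; exact: measurable_quad.
- by move=> z _; rewrite lee_fin le_max lexx.
- by rewrite lee_fin divr_ge0// sqr_ge0.
Qed.

Lemma mollifier_integrable d (D : set plane) : 0 < d -> measurable D ->
  (forall z, B d z != 0 -> D z) -> mu2.-integrable D (EFin \o B d).
Proof.
move=> d0 mD BD; apply/integrableP; split.
  by apply/measurable_EFinP; exact: measurable_mollifier.
have -> : (\int[mu2]_(z in D) `|(EFin \o B d) z| = \int[mu2]_(z in D) (B d z)%:E)%E.
  by apply: eq_integral => z _; rewrite /= ger0_norm// mollifier_ge0.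
by rewrite integral_mollifier// ltry.
Qed.

Local Notation beta2i := (GComplex beta 2 : A).

Lemma garea_mollifier d (D : set plane) : 0 < d -> measurable D ->
  (forall z, B d z != 0 -> D z) ->
  gintegrable D (fun z => B d z *: beta2i) /\
  garea_integral D (fun z => B d z *: beta2i) = mollifier_mass *: beta2i.
Proof.
move=> d0 mD BD; have iB := integral_mollifier d0 mD BD.
have intB := mollifier_integrable d0 mD BD.
have Z (a : R) : mu2.-integrable D (EFin \o (fun z => B d z * a)).
  by have := integrableZr mD a intB; apply: eq_integrable.
split; first by split; exact: Z.
by congr GComplex; rewrite /= RintegralZr// /Rintegral iB.
Qed.

Lemma garea_mollifier_bound d (D : set plane) (f : R * R -> A) e : 0 < d -> measurable D ->
  (forall z, B d z != 0 -> D z) -> gintegrable D (fun z => f z * (B d z *: beta2i)) ->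
  0 <= e -> (forall z, D z -> B d z != 0 -> gsize (f z) <= e) ->
  gsize (garea_integral D (fun z => f z * (B d z *: beta2i))) <=
  2 * ((1 + `|alpha| + `|beta|) * e * gsize beta2i) * mollifier_mass.
Proof.
move=> d0 mD BD [ir ii] e0 fe; have iB := integral_mollifier d0 mD BD.
have intB := mollifier_integrable d0 mD BD.
set C := _ * e * _.
have C0 : 0 <= C by rewrite !mulr_ge0 ?gsize_ge0 ?addr_ge0.
have fB z : D z -> gsize (f z * (B d z *: beta2i)) <= C * B d z.
  move=> Dz; apply: le_trans (gsizeM _ _) _; rewrite gsizeZ (ger0_norm (mollifier_ge0 _ _)).
  have [->|Bz] := eqVneq (B d z) 0; first by rewrite mul0r !mulr0.
  rewrite mulrA [leLHS]mulrAC /C ler_wpM2r ?mollifier_ge0// ler_wpM2r ?gsize_ge0//.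
  by rewrite ler_wpM2l ?addr_ge0//; exact: fe.
have bnd (g : R * R -> R) : mu2.-integrable D (EFin \o g) ->
    (forall z, D z -> `|g z| <= C * B d z) ->
    `|\int[mu2]_(z in D) g z| <= C * mollifier_mass.
  move=> ig gB; apply: le_trans (le_normr_Rintegral mD ig) _.
  have iCB : mu2.-integrable D (EFin \o (fun z => C * B d z)).
    by have := integrableZl mD C intB; apply: eq_integrable.
  apply: (@le_trans _ _ (\int[mu2]_(z in D) (C * B d z))).
    apply: le_Rintegral => //.
    by have := integrable_abse ig; apply: eq_integrable.
  by rewrite RintegralZl// /Rintegral iB.
rewrite /gsize /= (_ : 2 * C * mollifier_mass = C * mollifier_mass + C * mollifier_mass).
  apply: lerD; apply: bnd => // z Dz; apply: le_trans (fB z Dz).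
  - exact: (gsize_Re (f z * (B d z *: beta2i))).
  - exact: (gsize_Im (f z * (B d z *: beta2i))).
by ring.
Qed.

End EllipticKernel.

(** * The Cauchy-Pompeiu formula *)

Section CauchyPompeiu.
Context {R : realType} (alpha beta : R).
Context (elliptic : 0 < 4 * alpha - beta ^+ 2).
Local Notation A := (gcomplex alpha beta).
Local Notation plane := (measurableTypeR R * measurableTypeR R)%type.
Implicit Types (D : set (R * R)) (f g : R * R -> A).

Lemma nbhs_box (p : R * R) (P : R * R -> Prop) : (\forall z \near p, P z) ->
  exists2 r : R, 0 < r & forall z, box p r z -> P z.
Proof.
move=> /nbhs_ballP[e /= e0 eP]; exists (e / 2); first by rewrite divr_gt0.
move=> z /boxP[z1 z2]; apply: eP.
by split; rewrite /ball /= distrC; [apply: le_lt_trans z1 _|apply: le_lt_trans z2 _]; lra.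
Qed.

Lemma gcont_near D f z (e : R) : open D -> D z -> gcont (closure D) f -> 0 < e ->
  \forall y \near z, gsize (f y - f z) <= e.
Proof.
move=> oD Dz [fr fi] e0.
have cD (h : R * R -> R) : {within closure D, continuous h} -> h @ z --> h z.
  move=> ch; have : {in D, continuous h}.
    rewrite -continuous_open_subspace//.
    by apply: continuous_subspaceW ch; exact: subset_closure.
  by apply; exact/mem_set.
have e2 : 0 < e / 2 by rewrite divr_gt0.
move/cD/cvgrPdist_le : fr => /(_ _ e2) /= fr.
move/cD/cvgrPdist_le : fi => /(_ _ e2) /= fi.
near=> y; rewrite /gsize /= [in leLHS]distrC (distrC (gIm _)).
have h1 : `|gRe (f z) - gRe (f y)| <= e / 2 by near: y.
have h2 : `|gIm (f z) - gIm (f y)| <= e / 2 by near: y.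
by lra.
Unshelve. all: by end_near. Qed.

Lemma gcont_bounded D f : bounded_set D -> gcont (closure D) f ->
  exists2 M : R, 0 <= M & forall z, D z -> gsize (f z) <= M.
Proof.
move=> bD [/(within_closure_bounded bD)[M1 f1] /(within_closure_bounded bD)[M2 f2]].
exists (`|M1| + `|M2|); first by rewrite addr_ge0.
move=> z /subset_closure Dz; apply: lerD.
- exact: le_trans (f1 _ Dz) (ler_norm _).
- exact: le_trans (f2 _ Dz) (ler_norm _).
Qed.

Lemma boundary_notin D (gam : R -> R * R) t : open D -> boundary_curve D gam ->
  0 <= t <= 1 -> ~ D (gam t).
Proof.
move=> oD [_ _ gD] t01 Dt.
have : (gam @` `[0, 1]) (gam t) by exists t; rewrite //= in_itv.
by rewrite gD => -[_]; apply; move: oD; rewrite openE; apply.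
Qed.

Lemma eq_gline_dtilde (gam : R -> R * R) f g :
  (forall t, 0 <= t <= 1 -> f (gam t) = g (gam t)) ->
  gline_integral_dtilde gam f = gline_integral_dtilde gam g.
Proof.
move=> fg; rewrite /gline_integral_dtilde.
by congr (_ - _ * _); congr GComplex; apply: eq_Rintegral => t;
  rewrite inE /= in_itv /= => /fg ->.
Qed.

Variables (D : set plane) (gam : R -> R * R) (zeta : R * R) (f fx fy : R * R -> A).
Hypotheses (oD : open (D : set (R * R))) (bD : bounded_set (D : set (R * R)))
  (Dgam : boundary_curve D gam) (gg : green_gauss D gam) (Dz : D zeta)
  (f_C1 : gC1_with D f fx fy).

Local Notation F := (fun z => fx z + gi * fy z).
Local Notation ch := (cauchy_kernel alpha beta zeta).
Local Notation K := (cutker alpha beta zeta).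
Local Notation B := (mollifier alpha beta zeta).
Local Notation beta2i := (GComplex beta 2 : A).

Let mD : measurable D. Proof. exact: open_measurable2. Qed.

Let cf : gcont (closure D) f. Proof. by have [] := gC1_with_gcont f_C1. Qed.

Let cF : gcont (closure D) F.
Proof.
have [_ cx cy] := gC1_with_gcont f_C1.
by apply: gcontD => //; apply: gcontM => //; exact: gcont_cst.
Qed.

Lemma cauchy_integrable : gintegrable D (fun z => F z * ch z).
Proof.
have [r r0 Dr] := bounded_box zeta bD.
have [M M0 FM] := gcont_bounded bD cF.
have C0 := cauchy_bound_gt0 elliptic.
have [] // := @singular_garea_bound R alpha beta D (fun z => F z * ch z) zeta
  ((1 + `|alpha| + `|beta|) * M * cauchy_bound alpha beta) r mD.
- apply: gmeasM; first exact: gcont_gmeas.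
  exact: gmeas_cauchy.
- by apply: mulr_ge0; [rewrite mulr_ge0 ?addr_ge0|exact: ltW].
- move=> z Dz'; rewrite EFinM -muleA.
  apply: le_trans (lee_wpmul2l _ (gsize_cauchy zeta elliptic z)); last first.
    by rewrite lee_fin mulr_ge0 ?addr_ge0.
  rewrite -EFinM lee_fin; apply: le_trans (gsizeM _ _) _.
  by rewrite ler_wpM2r ?gsize_ge0// ler_wpM2l ?addr_ge0//; exact: FM.
- by move=> z Dz' _; exact: Dr.
Qed.

(** Green-Gauss is applied to f times the truncated kernel, with a truncation
    level d so small that the ellipse q < d lies in the box where f differs from
    f zeta by at most e and whose half-width is at most e. The factor T collects
    a bound for 2 dbar f and the constants of the two kernels. *)
Lemma cauchy_pompeiu_defect : exists2 T : R, 0 <= T & forall e : R, 0 < e ->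
  gsize (gline_integral_dtilde gam (fun z => f z * ch z)
         - garea_integral D (fun z => F z * ch z)
         - f zeta * (mollifier_mass alpha beta *: beta2i)) <= T * e.
Proof.
have [M M0 FM] := gcont_bounded bD cF.
have C0 := cauchy_bound_gt0 elliptic.
have k0 := coercivity_gt0 elliptic.
pose n : R := 1 + `|alpha| + `|beta|.
have n0 : 0 <= n by rewrite !addr_ge0.
pose T1 := n * M * cauchy_bound alpha beta * 32.
pose T2 := 2 * (n * gsize beta2i) * mollifier_mass alpha beta.
have T10 : 0 <= T1.
  by apply: mulr_ge0 => //; apply: mulr_ge0; [rewrite mulr_ge0|exact: ltW].
have mm0 : 0 <= mollifier_mass alpha beta.
  by rewrite divr_ge0 ?mulr_ge0 ?pi_ge0.
have T20 : 0 <= T2.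
  by apply: mulr_ge0 => //; apply: mulr_ge0 => //; rewrite mulr_ge0 ?gsize_ge0.
exists (T1 + T2); first by rewrite addr_ge0.
move=> e e0.
have [r r0 rP] : exists2 r : R, 0 < r & forall z, box zeta r z -> D z /\ gsize (f z - f zeta) <= e.
  apply: nbhs_box; near=> z; split; near: z.
    exact: open_nbhs_nbhs.
  exact: gcont_near cf e0.
pose rho := Num.min r e.
have rho0 : 0 < rho by rewrite lt_min r0.
have rhor : rho <= r by rewrite ge_min lexx.
have rhoe : rho <= e by rewrite ge_min lexx orbT.
have boxr z : box zeta rho z -> box zeta r z.
  by move=> /boxP[z1 z2]; apply/boxP; split; exact: le_trans rhor.
(* by coercivity q < d confines z to the box of half-width rho *)
pose d := coercivity alpha beta * rho ^+ 2.
have d0 : 0 < d by rewrite mulr_gt0// exprn_gt0.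
have Bbox z : B d z != 0 -> box zeta rho z.
  exact: (mollifier_box elliptic (ltW rho0)).
have BD z : B d z != 0 -> D z by move=> /Bbox/boxr/rP[].
have [kx [ky [K_C1 kE]]] := cutker_C1 alpha beta zeta D d0.
have [cK ckx cky] := gC1_with_gcont K_C1.
have cB : gcont (closure D) (fun z => B d z *: beta2i).
  rewrite (_ : (fun z => _) = (fun z => kx z + gi * ky z)); last exact/funext.
  by apply: gcontD => //; apply: gcontM => //; exact: gcont_cst.
have cfB : gcont (closure D) (fun z => f z * (B d z *: beta2i)) by exact: gcontM.
have cFK : gcont (closure D) (fun z => F z * K d z) by exact: gcontM.
have iFK := gcont_gintegrable oD bD cFK.
have ifB := gcont_gintegrable oD bD cfB.
have iB := gcont_gintegrable oD bD cB.
have iF := cauchy_integrable.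
have Kch z : ~ box zeta rho z -> K d z = ch z.
  move=> nz; apply: cutker_cauchy; rewrite leNgt; apply/negP => /quad_box.
  by move=> /(_ elliptic (ltW rho0)).
(* the boundary avoids the box, so K d and the Cauchy kernel agree on it *)
have -> : gline_integral_dtilde gam (fun z => f z * ch z) =
    garea_integral D (fun z => F z * K d z) +
    garea_integral D (fun z => f z * (B d z *: beta2i)).
  rewrite (@eq_gline_dtilde _ _ (fun z => f z * K d z)); last first.
    move=> t t01; rewrite Kch// => /boxr/rP[Dt _].
    exact: boundary_notin oD Dgam t01 Dt.
  rewrite (green_dtilde oD bD gg (gC1_withM f_C1 K_C1)) -garea_integralD//.
  by apply: eq_garea_integral => z _; rewrite -kE; ring.
have [_ beta2iE] := garea_mollifier elliptic d0 mD BD.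
rewrite -beta2iE -garea_integralMl// -[X in gsize X]addrA addrACA.
rewrite -garea_integralB// -garea_integralB//; last exact: gintegrableMl.
apply: le_trans (gsizeD _ _) _; rewrite mulrDl; apply: lerD.
- have [] := @singular_garea_bound R alpha beta D (fun z => F z * K d z - F z * ch z) zeta
    (n * M * cauchy_bound alpha beta) rho mD.
  + apply: gmeasB; first exact: gcont_gmeas.
    by apply: gmeasM; [exact: gcont_gmeas|exact: gmeas_cauchy].
  + by apply: mulr_ge0; [rewrite mulr_ge0|exact: ltW].
  + exact: rho0.
  + move=> z Dz'; rewrite EFinM -muleA.
    apply: le_trans (lee_wpmul2l _ (gsize_cauchy zeta elliptic z)); last first.
      by rewrite lee_fin mulr_ge0.
    rewrite -EFinM lee_fin -mulrBr; apply: le_trans (gsizeM _ _) _.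
    apply: ler_pM; rewrite ?mulr_ge0 ?gsize_ge0//.
      by rewrite ler_wpM2l//; exact: FM.
    exact: gsize_cutkerB.
  + move=> z Dz' ; apply: contraNP => /Kch ->; exact/eqP/subrr.
  move=> _ /le_trans; apply; rewrite /T1 mulrA ler_wpM2l//.
- rewrite (@eq_garea_integral _ _ _ _ _ (fun z => (f z - f zeta) * (B d z *: beta2i))); last first.
    by move=> z _; rewrite mulrBl.
  apply: le_trans (garea_mollifier_bound elliptic d0 mD BD _ (ltW e0) _) _.
  + apply: gcont_gintegrable => //; apply: gcontM => //.
    by apply: gcontD => //; exact: gcont_cst.
  + by move=> z _ /Bbox/boxr/rP[].
  + by rewrite /T2 -/n le_eqVlt; apply/orP; left; apply/eqP; ring.
Unshelve. all: by end_near. Qed.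

Lemma cauchy_pompeiu :
  gline_integral_dtilde gam (fun z => f z * ch z) =
  garea_integral D (fun z => F z * ch z)
  + f zeta * (mollifier_mass alpha beta *: beta2i).
Proof.
have [T T0 bnd] := cauchy_pompeiu_defect.
apply/eqP; rewrite -subr_eq0 opprD addrA; apply/eqP/gsize_eq0 => e e0.
have T1 : 0 < T + 1 by rewrite ltr_wpDl.
apply: le_trans (bnd (e / (T + 1)) _) _; first by rewrite divr_gt0.
by rewrite mulrCA ler_piMr ?(ltW e0)// ler_pdivrMr// mul1r lerDl.
Qed.

End CauchyPompeiu.

(** Both sides are the total mass of 2 dbar (cutker d). *)
Lemma ghatE (R : realType) (alpha beta : R) :
  2 * pi *: ghat alpha beta =
  mollifier_mass alpha beta *: (GComplex beta 2 : gcomplex alpha beta).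
Proof.
rewrite /ghat /mollifier_mass scalerA; congr (_ *: _).
by congr GComplex => /=; ring.
Qed.

Theorem theorem1 (R : realType) (alpha beta : R)
    (elliptic : 0 < 4 * alpha - beta ^+ 2)
    (Omega : set (R * R)) (gamma : R -> R * R) (zeta : R * R)
    (f : R * R -> gcomplex alpha beta)
    (Omega_domain : domain Omega)
    (Omega_simply_connected : simply_connected Omega)
    (Omega_bounded : bounded_set Omega)
    (gamma_boundary : boundary_curve Omega gamma)
    (gamma_positive : positively_oriented Omega gamma)
    (boundary_smooth : green_gauss Omega gamma)
    (Omega_zeta : Omega zeta)
    (f_C1 : gC1_closure Omega f) :
  f zeta =
    (2 * pi *: ghat alpha beta)^-1 *
      gline_integral_dtilde gamma
        (fun z => f z / gtilde (gof_pair z - gof_pair zeta))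
    - (pi *: ghat alpha beta)^-1 *
      garea_integral Omega
        (fun z => dbar f z / gtilde (gof_pair z - gof_pair zeta)).
Proof.
have oO : open Omega by case: Omega_domain.
have mO := open_measurable2 oO.
have [fx [fy fC1]] := (gC1_closureP _ _).1 f_C1.
pose F z := fx z + gi * fy z.
pose ch := cauchy_kernel alpha beta zeta.
have iF : gintegrable Omega (fun z => F z * ch z).
  exact: (cauchy_integrable elliptic zeta oO Omega_bounded fC1).
have E : (fun z => f z / gtilde (gof_pair z - gof_pair zeta)) = (fun z => f z * ch z).
  by apply/funext => z; rewrite -[gtilde _]/(tilde_diff alpha beta zeta z) cauchyE.
have -> : garea_integral Omega
    (fun z => dbar f z / gtilde (gof_pair z - gof_pair zeta)) =
    2^-1%:A * garea_integral Omega (fun z => F z * ch z).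
  rewrite -garea_integralMl//.
  apply: eq_garea_integral => z; rewrite inE => Oz.
  rewrite -[gtilde _]/(tilde_diff alpha beta zeta z) cauchyE// /F -(gC1_with_dbar fC1 Oz).
  by rewrite mulr_algl scalerAl scalerA mulVf ?pnatr_eq0// scale1r.
set U := 2 * pi *: ghat alpha beta; set V := pi *: ghat alpha beta.
have s0 : 0 < Num.sqrt (4 * alpha - beta ^+ 2) by rewrite sqrtr_gt0.
have Uunit : U \is a GRing.unit.
  rewrite gunit_elliptic// /U ghatE scaler_eq0 negb_or; apply/andP; split.
    by rewrite gt_eqF// divr_gt0// mulr_gt0// pi_gt0.
  by apply/eqP => -[_ /eqP]; rewrite pnatr_eq0.
have UV : U = 2%:A * V by rewrite mulr_algl scalerA.
have Vunit : V \is a GRing.unit by move: Uunit; rewrite UV unitrM => /andP[].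
rewrite E (cauchy_pompeiu elliptic oO Omega_bounded gamma_boundary boundary_smooth Omega_zeta fC1).
rewrite -ghatE -/U -/F -/ch.
have -> : V^-1 * (2^-1%:A * garea_integral Omega (fun z => F z * ch z)) =
    U^-1 * garea_integral Omega (fun z => F z * ch z).
  apply: (mulrI Uunit); rewrite !mulrA divrr// mul1r UV -mulrA mulrCA mulrA.
  rewrite mulrK// mulr_algl scalerA mulVf ?pnatr_eq0// scale1r mul1r.
  by [].
by rewrite mulrDr addrAC subrr add0r mulrCA mulVr// mulr1.
Qed.
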